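(* Let $H=\sum_{J\in S}H_J$ be a site-local Hamiltonian on a lattice with $\mathsf N_\Lambda=\mathcal O(1)$ sites (so $\mathsf N_H=\mathcal O(1)$) with parameters $\mathsf N_P,\mathsf c_P$, and let $t>0$, $\varepsilon>0$. Then there exists a quantum circuit which is a $(1\pm\mathcal O(\varepsilon),\mathcal O(\log\mathsf N_P))$-block-encoding of an operator $A$ with $\|A-e^{-iHt}\|\le\varepsilon$, and whose elementary gate count is $$\chi=\mathcal O\!\Big[\mathsf N_P\log\mathsf N_P\big(\mathsf N_P\mathsf c_P t+\log(1/\varepsilon)\big)\Big].$$
   Context: A $\mathsf k$-site-local Hamiltonian on a finite lattice $\Lambda$ ($\mathsf N_\Lambda=|\Lambda|$, each site carrying $\mathsf n_q$ qubits) is $H=\sum_{J\in S}H_J$, with $S$ a set of subsets of at most $\mathsf k$ sites, each $H_J$ Hermitian acting only on the qubits of the sites in $J$; $\mathsf N_H=|S|$. Each $H_J=\sum_{i=1}^{\mathsf N_P^{(J)}}c_i^{(J)}P_i^{(J)}$ (distinct Pauli strings, nonzero coefficients); $\mathsf N_P=\max_J\mathsf N_P^{(J)}$, $\mathsf c_P=\max_{J,i}|c_i^{(J)}|$. For $\alpha>0$ and integer $k\ge0$, a unitary $U$ on $\mathcal H_a\otimes\mathcal H_s$ ($\mathcal H_a$ the space of $k$ ancilla qubits) is an $(\alpha,k)$-block-encoding of an operator $A$ on $\mathcal H_s$ if there is a state $|g\rangle_a$ with $(\langle g|_a\otimes I_s)U(|g\rangle_a\otimes I_s)=A/\alpha$.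 Cost model: elementary gates from a fixed universal set; a (controlled) Pauli string is counted as a constant number of gates and a gate controlled on $m$ qubits costs $\mathcal O(m)$ gates. *)

(* Defs.v *)
From HB Require Import structures.
From mathcomp Require Import all_boot all_order all_algebra.
From mathcomp Require Import all_classical all_reals all_analysis.
From mathcomp.real_closed Require Import complex.
Set Implicit Arguments. Unset Strict Implicit. Unset Printing Implicit Defensive.
Import Order.TTheory GRing.Theory Num.Theory.
Import numFieldNormedType.Exports.
Local Open Scope ring_scope.

Section QuantumDefs.
Variable R : realType.
Local Notation C := (R[i]).

(* n-qubit registers: basis states are 'I_(2^n); qubit q of basis    *)
(* index x is the q-th binary digit of x (qubit 0 = least significant)*)
Definition bit (q x : nat) : bool := odd (x %/ 2 ^ q)%N.

Definition b2o (b : bool) : 'I_2 := if b then ord_max else ord0.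

Definition sigma (p : 'I_4) : 'M[C]_2 :=
  match val p with
  | 0 => 1%:M
  | 1 => \matrix_(i < 2, j < 2) (if i == j then 0 else 1)
  | 2 => \matrix_(i < 2, j < 2)
           (if i == j then 0 else if (i : nat) == 0%N then Complex 0 (-1) else Complex 0 1)
  | _ => \matrix_(i < 2, j < 2) (if i == j then (if (i : nat) == 0%N then 1 else -1) else 0)
  end.

(* A Pauli string on n qubits and its matrix (tensor product of the sigma's). *)
Definition pstring (n : nat) := {ffun 'I_n -> 'I_4}.

Definition pauli_mx (n : nat) (P : pstring n) : 'M[C]_(2 ^ n) :=
  \matrix_(x, y) \prod_(q < n) sigma (P q) (b2o (bit q x)) (b2o (bit q y)).

Definition one_qubit_mx (n : nat) (j : 'I_n) (u : 'M[C]_2) : 'M[C]_(2 ^ n) :=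
  \matrix_(x, y)
    (if [forall q : 'I_n, (q != j) ==> (bit q x == bit q y)]
     then u (b2o (bit j x)) (b2o (bit j y)) else 0).

(* Elementary gates.  Following the paper's cost model, an elementary  *)
(* gate is a (possibly multi-controlled) single-qubit unitary or a     *)
(* (possibly multi-controlled) Pauli string; a gate controlled on m    *)
(* qubits costs 1 + m (so uncontrolled / singly-controlled Pauli       *)
(* strings cost O(1), and CNOT = X controlled on one qubit).           *)
(* ctrl q = Some b : qubit q must be in state |b> for the gate to act. *)
Inductive base_gate (n : nat) :=
  | BUnitary of 'I_n & 'M[C]_2
  | BPauli of pstring n.

Record gate (n : nat) := Gate { g_ctrl : {ffun 'I_n -> option bool};
                                g_base : base_gate n }.

Definition ctrl_ok (n : nat) (c : {ffun 'I_n -> option bool}) (x : nat) : bool :=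
  [forall q : 'I_n, if c q is Some b then bit q x == b else true].

Definition base_mx (n : nat) (b : base_gate n) : 'M[C]_(2 ^ n) :=
  match b with
  | BUnitary j u => one_qubit_mx j u
  | BPauli P => pauli_mx P
  end.

Definition gate_wf (n : nat) (g : gate n) : Prop :=
  match g_base g with
  | BUnitary j u => u *m (map_mx Num.conj u)^T = 1%:M /\ g_ctrl g j = None
  | BPauli P => forall q, g_ctrl g q != None -> P q = 0
  end.

Definition gate_mx (n : nat) (g : gate n) : 'M[C]_(2 ^ n) :=
  \matrix_(x, y)
    (if ctrl_ok (g_ctrl g) y
     then (if ctrl_ok (g_ctrl g) x then base_mx (g_base g) x y else 0)
     else (x == y)%:R).

Definition gate_cost (n : nat) (g : gate n) : nat :=
  1 + #|[set q | g_ctrl g q != None]|.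

Definition circuit (n : nat) := seq (gate n).

Definition circuit_wf (n : nat) (c : circuit n) : Prop :=
  forall i, (i < size c)%N -> gate_wf (nth (Gate [ffun=> None] (BPauli [ffun=> 0])) c i).

Definition circuit_mx (n : nat) (c : circuit n) : 'M[C]_(2 ^ n) :=
  foldl (fun M g => gate_mx g *m M) 1%:M c.

Definition circuit_cost (n : nat) (c : circuit n) : nat :=
  \sum_(g <- c) gate_cost g.

(* Block-encodings.  H_a (k ancilla qubits) is the high-order part:   *)
(* basis state |a>|s> of k + m qubits has index a * 2^m + s.          *)
Lemma tidx_proof (k m : nat) (a : 'I_(2 ^ k)) (s : 'I_(2 ^ m)) :
  (a * 2 ^ m + s < 2 ^ (k + m))%N.
Proof.
rewrite expnD.
apply: (@leq_trans ((a.+1) * 2 ^ m)%N).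
  by rewrite mulSn [(2 ^ m + _)%N]addnC ltn_add2l.
by rewrite leq_mul2r ltn_ord orbT.
Qed.

Definition tidx (k m : nat) (a : 'I_(2 ^ k)) (s : 'I_(2 ^ m)) : 'I_(2 ^ (k + m)) :=
  Ordinal (tidx_proof a s).

Definition vnorm2 (d : nat) (v : 'cV[C]_d) : C := \sum_i `|v i 0| ^+ 2.

Definition block_encoding (k m : nat) (U : 'M[C]_(2 ^ (k + m))) (alpha : R)
    (A : 'M[C]_(2 ^ m)) : Prop :=
  0 < alpha /\
  exists g : 'cV[C]_(2 ^ k), vnorm2 g = 1 /\
    forall s s' : 'I_(2 ^ m),
      \sum_(a < 2 ^ k) \sum_(a' < 2 ^ k)
         Num.conj (g a 0) * U (tidx a s) (tidx a' s') * g a' 0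
      = A s s' / (alpha%:C)%C.

Definition opnorm_le (d : nat) (A : 'M[C]_d) (eps : R) : Prop :=
  forall v : 'cV[C]_d, vnorm2 (A *m v) <= ((eps ^+ 2)%:C)%C * vnorm2 v.

Definition mexp (d : nat) (M : 'M[C]_d) : 'M[C]_d :=
  \matrix_(i, j)
    (let s := fun N : nat => (\sum_(k < N) (k`!%:R)^-1 *: M ^+ k) i j in
     (limn (fun N => complex.Re (s N)) +i* limn (fun N => complex.Im (s N)))%C).

(* Site-local Hamiltonians on NL sites with nq qubits each            *)
(* (system qubit q belongs to site q %/ nq).                          *)
(* S : the set of supports J; dec J : Pauli decomposition of H_J as   *)
(* a list of (Pauli string, real coefficient) pairs.                  *)
Definition pstring_on (NL nq : nat) (J : {set 'I_NL}) (P : pstring (NL * nq)) : bool :=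
  [forall q : 'I_(NL * nq), (P q != 0) ==> [exists j in J, (j : nat) == (q %/ nq)%N]].

Definition site_local (NL nq kloc : nat) (S : {set {set 'I_NL}})
    (dec : {set 'I_NL} -> seq (pstring (NL * nq) * R)) : Prop :=
  forall J, J \in S ->
    [/\ (#|J| <= kloc)%N,
        uniq (map fst (dec J)),
        all (fun pc => pc.2 != 0) (dec J)
      & all (fun pc => pstring_on J pc.1) (dec J)].

Definition ham_mx (NL nq : nat) (S : {set {set 'I_NL}})
    (dec : {set 'I_NL} -> seq (pstring (NL * nq) * R)) : 'M[C]_(2 ^ (NL * nq)) :=
  \sum_(J in S) \sum_(pc <- dec J) ((pc.2)%:C)%C *: pauli_mx pc.1.

Definition NP_of (NL nq : nat) (S : {set {set 'I_NL}})
    (dec : {set 'I_NL} -> seq (pstring (NL * nq) * R)) : nat :=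
  \max_(J in S) size (dec J).

Definition cP_of (NL nq : nat) (S : {set {set 'I_NL}})
    (dec : {set 'I_NL} -> seq (pstring (NL * nq) * R)) : R :=
  \big[Num.max/0]_(J in S) \big[Num.max/0]_(pc <- dec J) `|pc.2|.

End QuantumDefs.

(* Main.v *)
Require Import Defs.
From Stdlib Require List.
From HB Require Import structures.
From mathcomp Require Import all_boot all_order all_algebra.
From mathcomp Require Import all_classical all_reals all_analysis.
From mathcomp.real_closed Require Import complex.
From mathcomp Require Import ring lra zify.
Set Implicit Arguments. Unset Strict Implicit. Unset Printing Implicit Defensive.
Import Order.TTheory GRing.Theory Num.Theory.
Import numFieldNormedType.Exports.
Local Open Scope ring_scope.

(** The Hamiltonian is a sum of at most [2 ^ a] weighted Pauli strings with weights at most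
    [cP], where [2 ^ a = O(NP)].  Conjugating by Hadamard gates on [a] label qubits and storing each
    weight in a reflection of one further qubit gives an involution [U] whose corner [Pi U Pi],
    with [Pi] the projection on the all-zero ancilla state, is the average [S] of the terms,
    that is [H / (2 ^ a cP)].  For the walk [W = (1 - 2 Pi) U] the operator [X = (W + W^-1) / 2]
    satisfies [X Pi = - Pi S], so that [p(X)], a Laurent polynomial in [W], has corner [p(- S)].
    Taking for [p] the exponential series truncated at degree [K = O(2 ^ a cP t + log (1 / eps))]
    approximates [exp(- i H t)] up to [eps], and on the unit circle [p] is bounded by [1 + 2 eps].
    With [alpha = 1 + 3 eps], the polynomial [P = z ^ K p / alpha] is therefore strictly bounded by
    1 on the circle, so it has a Fejer-Riesz complement [Q] with [|P|^2 + |Q|^2 = 1], and peeling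
    off one degree at a time realizes [P(W)] by interleaving [2 K] controlled walks with rotations
    of a single signal qubit. *)

(** * Fejer-Riesz factorization and quantum signal processing *)

(** The block-encoded operator is the truncated series itself, exactly, so truncation is the only
    source of error. One bound [T] on the finite tails of the exponential series at
    [tau = 2 ^ a cP t] therefore serves twice: as the operator-norm error, and as the source of the
    bound 1 + 2 T on the circle, where p becomes a partial sum of exp(i tau cos theta) and the
    cosine and sine series each err by at most [T]. The scale 1 + 3 eps leaves strict room, because
    the factorization takes one root from each pair w0, 1 / conj(w0), and a root on the circle would
    be its own partner. The minus sign in X Pi = - Pi S is absorbed by expanding at i tau, since i
    tau (- S) = - i t H. The factor z ^ K turns a Laurent polynomial into an ordinary one of degree
    at most 2 K; after the signal processing, [K] uncontrolled inverse walks remove it again.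
    Normalizing all weights by the single bound [cP] lets plain Hadamard gates prepare the labels;
    the price is the factor NP cP in [tau]. Each walk costs O(NP log NP), which multiplies the
    degree. *)

Section SignalProcessing.
Variable C : numClosedFieldType.
Implicit Types (P Q N : {poly C}) (w z : C).

(** Identities involving [cinv w] make sense only off 0. In characteristic zero the points 1, 2, 3,
    ... supply enough nonzero roots of the difference. *)
Lemma poly_eq_nz P Q : (forall w, w != 0 -> P.[w] = Q.[w]) -> P = Q.
Proof.
move=> PQ; apply/eqP; rewrite -subr_eq0; apply/eqP.
set r := P - Q; pose s := [seq (i.+1)%:R : C | i <- iota 0 (size r)].
apply: (@roots_geq_poly_eq0 _ r s).
- apply/allP => _ /mapP[i _ ->].
  by rewrite /root /r !hornerE PQ ?subrr // pnatr_eq0.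
- rewrite map_inj_uniq ?iota_uniq // => i j /eqP.
  by rewrite eqr_nat => /eqP[].
- by rewrite size_map size_iota.
Qed.

(** Reflection in the unit circle. It fixes the circle pointwise, so [P.[w] * (P.[cinv w])^*]
    continues |P|^2 from the circle to all nonzero [w] as a Laurent polynomial. *)
Definition cinv w := (w^*)^-1.

Lemma cinv_neq0 w : w != 0 -> cinv w != 0.
Proof. by move=> w0; rewrite invr_eq0 fmorph_eq0. Qed.

Lemma conj_cinv w : (cinv w)^* = w^-1.
Proof. by rewrite /cinv fmorphV /= conjCK. Qed.

Lemma cinvK : involutive cinv.
Proof. by move=> w; rewrite /cinv fmorphV /= conjCK invrK. Qed.

Lemma cinv_circle z : z * z^* = 1 -> cinv z = z.
Proof.
move=> zz; rewrite /cinv -[RHS]mulr1.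
have z0 : z^* != 0.
  by apply/eqP => z0; move: zz; rewrite z0 mulr0 => /esym/eqP; rewrite oner_eq0.
by rewrite -(divff z0) mulrA zz mul1r.
Qed.

(** The conjugate-reciprocal polynomial. The nominal degree [d] is a parameter because the top
    coefficient of [P] may vanish. *)
Definition star d P := \poly_(i < d.+1) (P`_(d - i))^*.

Lemma size_star d P : (size (star d P) <= d.+1)%N.
Proof. exact: size_poly. Qed.

Lemma star_horner d P w : (size P <= d.+1)%N -> w != 0 ->
  (star d P).[w] = w ^+ d * (P.[cinv w])^*.
Proof.
move=> sP w0; rewrite horner_poly (horner_coef_wide _ sP) rmorph_sum mulr_sumr.
rewrite (reindex_inj rev_ord_inj) /=; apply: eq_bigr => i _.
have id : (i <= d)%N by rewrite -ltnS.
rewrite rmorphM rmorphXn /= conj_cinv subSS subKn // mulrCA exprVn.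
have -> : w ^+ d = w ^+ (d - i) * w ^+ i by rewrite -exprD subnK.
by rewrite mulfK // expf_neq0.
Qed.

(** The quadratic factor is self-reciprocal, so dividing it out of a self-reciprocal polynomial
    leaves a self-reciprocal quotient. *)
Lemma cinv_root_factor w w0 : w != 0 ->
  (w - w0) * (1 - w0^* * w) = w ^+ 2 * ((cinv w - w0) * (1 - w0^* * cinv w))^*.
Proof.
move=> nz; rewrite rmorphM !rmorphB /= conj_cinv rmorphM rmorph1 /= conjCK conj_cinv.
by field.
Qed.

(** Roots of a self-reciprocal polynomial come in pairs [w0], [cinv w0]; positivity keeps them off
    the circle, so that the two differ and both linear factors divide [N]. The form [1 - w0^* *: 'X]
    of the second factor also covers [w0 = 0], whose partner lies at infinity. *)
Lemma fejer_riesz_factor d N : (size N <= d.+1.*2.+1)%N -> star d.+1.*2 N = N ->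
  (forall z, z * z^* = 1 -> 0 < N.[z] * z^* ^+ d.+1) ->
  exists w0 M, [/\ N = ('X - w0%:P) * (1 - w0^* *: 'X) * M & (size M <= d.*2.+1)%N].
Proof.
move=> sN symN posN.
have N0 : N != 0.
  apply/eqP => N0; have := posN 1; rewrite N0 rmorph1 mulr1 horner0 mul0r ltxx.
  by move/(_ erefl).
have top : N`_(d.+1.*2) = (N`_0)^*.
  by rewrite -{1}symN coef_poly ltnSn subnn.
have sN2 : N`_0 = 0 -> (size N <= d.+1.*2)%N.
  move=> N00; rewrite N00 rmorph0 in top; apply/leq_sizeP => j.
  rewrite leq_eqVlt => /predU1P[<- //|dj].
  by rewrite nth_default // (leq_trans sN).
(* Without a root [N] would be a nonzero constant, yet its top coefficient, at a positive index, is
   the conjugate of the constant term. *)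
have [w0 /rootP Nw0] : exists w0, root N w0.
  apply/closed_rootP; apply/negP => /size_poly1P[c c0 Nc].
  have : N`_0 != 0 by rewrite Nc coefC.
  by rewrite -conjC_eq0 -top Nc coefC eqxx.
(* A root at 0 kills the constant coefficient and, by symmetry, the top one, so dividing by ['X]
   lowers the size bound by two. *)
exists w0; have [w00|w0n0] := eqVneq w0 0.
  have dN : 'X %| N by rewrite -['X]subr0 dvdp_XsubCl /root -[X in N.[X]]w00 Nw0.
  move/dvdpP: dN => [M NM]; exists M; split.
    by rewrite w00 conjC0 scale0r !subr0 mulr1 mulrC.
  have M0 : M != 0 by apply: contraNneq N0 => M0; rewrite NM M0 mul0r.
  have : (size N <= d.+1.*2)%N by apply: sN2; rewrite -horner_coef0 -[X in N.[X]]w00.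
  by rewrite NM size_mulX // doubleS.
have circ : w0 * w0^* != 1.
  by apply/eqP => c; have := posN _ c; rewrite Nw0 mul0r ltxx.
have w0c : cinv w0 != w0.
  apply: contraNneq circ => e; rewrite -{1}e mulVf // fmorph_eq0 //.
have Nc : N.[cinv w0] = 0.
  by rewrite -symN star_horner ?cinv_neq0 // cinvK Nw0 rmorph0 mulr0.
have : ('X - w0%:P) * ('X - (cinv w0)%:P) %| N.
  rewrite Gauss_dvdp; last by rewrite coprimep_XsubC root_XsubC.
  by rewrite !dvdp_XsubCl /root Nw0 Nc eqxx.
move=> /dvdpP[M NM]; exists (- (w0^*)^-1 *: M).
have M0 : M != 0 by apply: contraNneq N0 => M0; rewrite NM M0 mul0r.
have s2 : size (('X - w0%:P) * ('X - (cinv w0)%:P)) = 3.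
  by rewrite size_Mmonic ?monicXsubC ?monic_neq0 ?monicXsubC // !size_XsubC.
split.
  rewrite NM mulrC -!mulrA; congr (_ * _); rewrite -scalerAr scalerAl; congr (_ * _).
  rewrite scalerBr scalerA mulNr mulVf ?fmorph_eq0 // scaleN1r opprK addrC.
  by rewrite scaleNr -mul_polyC mulr1.
apply: leq_trans (size_scale_leq _ _) _.
have q0 : ('X - w0%:P) * ('X - (cinv w0)%:P) != 0 by rewrite -size_poly_eq0 s2.
by move: sN; rewrite NM (size_mul M0 q0) s2 addn3 /= doubleS !ltnS.
Qed.

(** [Q] collects one root from each reflected pair, and each induction step removes one pair. *)
Lemma fejer_riesz d N : (size N <= d.*2.+1)%N -> star d.*2 N = N ->
  (forall z, z * z^* = 1 -> 0 < N.[z] * z^* ^+ d) ->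
  exists Q, (size Q <= d.+1)%N /\
    forall w, w != 0 -> N.[w] = w ^+ d * (Q.[w] * (Q.[cinv w])^*).
Proof.
elim: d N => [|d IH] N sN symN posN.
  have [c Nc] : exists c, N = c%:P by exists N`_0; apply: size1_polyC.
  have c0 : 0 < c by have := posN 1; rewrite conjC1 expr0 !mulr1 Nc hornerC; apply.
  exists (sqrtC c)%:P; split; first exact: size_polyC_leq1.
  move=> w _; rewrite Nc !hornerC expr0 mul1r.
  have -> : (sqrtC c)^* = sqrtC c by apply/CrealP/ger0_real; rewrite sqrtC_ge0 ltW.
  by rewrite -expr2 sqrtCK.
have [w0 [M [NM sM]]] := fejer_riesz_factor sN symN posN.
have N0 : N != 0.
  apply/eqP => N0; have := posN 1; rewrite N0 rmorph1 mulr1 horner0 mul0r ltxx.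
  by move/(_ erefl).
have NE w : N.[w] = (w - w0) * (1 - w0^* * w) * M.[w] by rewrite NM !hornerE.
have symM : star d.*2 M = M.
  apply: (@mulfI _ (('X - w0%:P) * (1 - w0^* *: 'X))).
    by apply: contraNneq N0 => f0; rewrite NM f0 mul0r.
  rewrite -NM; apply: poly_eq_nz => w wn0; rewrite -symN (star_horner sN wn0).
  rewrite NE rmorphM doubleS !hornerE (star_horner sM wn0) (cinv_root_factor w0 wn0).
  by rewrite -[d.*2.+2]addn2 exprD /=; ring.
(* On the circle the quadratic factor, turned by [z^*], is |z - w0|^2, so the quotient [M] stays
   positive there. *)
have factor_pos z : z * z^* = 1 -> (z - w0) * (1 - w0^* * z) * z^* = `|z - w0| ^+ 2.
  move=> zz; rewrite normCK rmorphB -mulrA; congr (_ * _).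
  by rewrite mulrBl mul1r -mulrA zz mulr1.
have posM z : z * z^* = 1 -> 0 < M.[z] * z^* ^+ d.
  move=> zz; have := posN z zz; rewrite NE exprS.
  have -> : (z - w0) * (1 - w0^* * z) * M.[z] * (z^* * z^* ^+ d) =
    ((z - w0) * (1 - w0^* * z) * z^*) * (M.[z] * z^* ^+ d) by ring.
  rewrite factor_pos // => pos; have := pos; rewrite pmulr_rgt0 //.
  rewrite lt_def exprn_ge0 ?normr_ge0 // andbT; apply: contraTneq pos => ->.
  by rewrite mul0r ltxx.
have [Q [sQ MQ]] := IH M sM symM posM.
exists (('X - w0%:P) * Q); split.
  have [->|Q0] := eqVneq Q 0; first by rewrite mulr0 size_poly0.
  by rewrite size_monicM ?monicXsubC // size_XsubC.
move=> w wn0; rewrite NE (MQ w wn0) !hornerE rmorphM rmorphB /= conj_cinv exprS.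
by field.
Qed.

(** * Quantum signal processing: a complementary pair as a product of rotations *)

Definition unitary n (u : 'M[C]_n) := u *m (map_mx Num.conj u)^T = 1%:M.

Definition mx2 (a b c d : C) : 'M[C]_2 :=
  \matrix_(i, j) if i == 0 then (if j == 0 then a else b) else (if j == 0 then c else d).

Lemma unitary_mx2 a b c d : a * a^* + b * b^* = 1 -> c * c^* + d * d^* = 1 ->
  a * c^* + b * d^* = 0 -> unitary (mx2 a b c d).
Proof.
move=> h1 h2 h3; rewrite /unitary; apply/matrixP => i j.
rewrite !mxE big_ord_recl big_ord1 !mxE /=.
have h4 : c * a^* + d * b^* = 0.
  by rewrite -[c]conjCK -[d]conjCK -!rmorphM -rmorphD /= mulrC [d^* * _]mulrC h3 rmorph0.
by case: i => [[|[]]] // ?; case: j => [[|[]]] // ?; rewrite ?(mulr1n, mulr0n).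
Qed.

(** The hypothesis says that [(p0, q0)] and [(pd, qd)] are orthogonal in C^2. Hence one rotation
    sends the first to the lower axis and the second to the upper axis; it is read off from
    whichever vector is nonzero. *)
Lemma rotate_orthogonal (p0 q0 pd qd : C) : p0 * pd^* + q0 * qd^* = 0 ->
  exists x y, [/\ x * x^* + y * y^* = 1, x * p0 + y * q0 = 0 &
    - y^* * pd + x^* * qd = 0].
Proof.
move=> orth.
have norm (a b : C) : (a != 0) || (b != 0) ->
    let n := sqrtC (a * a^* + b * b^*) in
    [/\ n != 0, n^* = n & a / n * (a / n)^* + b / n * (b / n)^* = 1].
  move=> ab n; have pos : 0 < a * a^* + b * b^*.
    rewrite -!normCK; case/orP: ab => h.
      by rewrite ltr_wpDr ?exprn_ge0 ?exprn_gt0 ?normr_gt0.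
    by rewrite ltr_wpDl ?exprn_ge0 ?exprn_gt0 ?normr_gt0.
  have n0 : n != 0 by rewrite sqrtC_eq0 gt_eqF.
  have nr : n^* = n by apply/CrealP/ger0_real; rewrite sqrtC_ge0 ltW.
  split=> //; rewrite !fmorph_div /= nr.
  have -> : a / n * (a^* / n) + b / n * (b^* / n) = (a * a^* + b * b^*) / n ^+ 2 by field.
  by rewrite sqrtCK divff // gt_eqF.
have [/norm[n0 nr nn]|] := boolP ((q0 != 0) || (p0 != 0)).
  set n := sqrtC _ in n0 nr nn; exists (q0 / n), (- (p0 / n)); split.
  - by rewrite rmorphN mulrNN.
  - by ring.
  - rewrite rmorphN opprK !fmorph_div /= nr.
    have -> : p0^* / n * pd + q0^* / n * qd = (p0 * pd^* + q0 * qd^*)^* / n.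
      by rewrite rmorphD !rmorphM /= !conjCK; ring.
    by rewrite orth rmorph0 mul0r.
rewrite negb_or !negbK => /andP[/eqP -> /eqP ->].
have [/norm[n0 nr nn]|] := boolP ((pd != 0) || (qd != 0)).
  set n := sqrtC _ in n0 nr nn; exists (pd / n)^*, (qd / n)^*; split.
  - by rewrite !conjCK mulrC [_^* * _]mulrC.
  - by rewrite !mulr0 addr0.
  - by rewrite !conjCK; ring.
rewrite negb_or !negbK => /andP[/eqP -> /eqP ->]; exists 1, 0.
by rewrite conjC1 conjC0; split; ring.
Qed.

(** First column of R diag('X, 1) ... diag('X, 1) R0, the head of the list being the rotation
    applied last. The factor diag('X, 1) models a walk controlled on the signal value 0. *)
Fixpoint qsp (R0 : 'M[C]_2) (Rs : seq 'M[C]_2) : {poly C} * {poly C} :=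
  if Rs is R :: Rs' then
    let PQ := qsp R0 Rs' in
    (R 0 0 *: ('X * PQ.1) + R 0 1 *: PQ.2, R 1 0 *: ('X * PQ.1) + R 1 1 *: PQ.2)
  else ((R0 0 0)%:P, (R0 1 0)%:P).

Lemma qsp_exists d P Q : (size P <= d.+1)%N -> (size Q <= d.+1)%N ->
  (forall w, w != 0 -> P.[w] * (P.[cinv w])^* + Q.[w] * (Q.[cinv w])^* = 1) ->
  exists R0 Rs, [/\ unitary R0, List.Forall (@unitary 2) Rs, size Rs = d
    & qsp R0 Rs = (P, Q)].
Proof.
elim: d P Q => [|d IH] P Q sP sQ PQ1.
  have [p Pp] : exists p, P = p%:P by exists P`_0; apply: size1_polyC.
  have [q Qq] : exists q, Q = q%:P by exists Q`_0; apply: size1_polyC.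
  have := PQ1 1 (oner_neq0 _); rewrite Pp Qq !hornerC => pq.
  exists (mx2 p (- q^*) q p^*), [::]; split => //=; last by rewrite !mxE.
  apply: unitary_mx2; rewrite ?rmorphN /= ?conjCK -?pq; ring.
(* Cleared of denominators, the normalization is a polynomial identity with right side ['X^(d.+1)];
   its constant term says that the lowest and the highest coefficient vectors are orthogonal. *)
have orth : P`_0 * (P`_d.+1)^* + Q`_0 * (Q`_d.+1)^* = 0.
  have : P * star d.+1 P + Q * star d.+1 Q = 'X^(d.+1).
    apply: poly_eq_nz => w w0; rewrite !hornerE !star_horner //.
    by rewrite !(mulrCA _ (w ^+ d.+1)) -mulrDr PQ1 // mulr1.
  move/(congr1 (fun p : {poly C} => p`_0)).
  by rewrite coefD !coef0M !coef_poly /= !subn0 coefXn.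
have [x [y [xy xy0 xyd]]] := rotate_orthogonal orth.
(* [P1] loses its constant term and [Q1] its top coefficient, so [P1] divided by ['X] and [Q1] both
   have degree at most [d]. *)
set P1 := x *: P + y *: Q; set Q1 := - y^* *: P + x^* *: Q.
have PE : P = x^* *: P1 - y *: Q1.
  by apply/polyP => i; rewrite !(coefB, coefD, coefZ) -[LHS]mul1r -xy; ring.
have QE : Q = y^* *: P1 + x *: Q1.
  by apply/polyP => i; rewrite !(coefB, coefD, coefZ) -[LHS]mul1r -xy; ring.
have [P2 P12] : exists P2, P1 = 'X * P2.
  have /factor_theorem[P2 ->] : root P1 0 by rewrite /root horner_coef0 !coefE xy0.
  by exists P2; rewrite subr0 mulrC.
have sP1 : (size P1 <= d.+2)%N.
  by rewrite (leq_trans (size_polyD _ _)) // geq_max !(leq_trans (size_scale_leq _ _)).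
have sP2 : (size P2 <= d.+1)%N.
  have [->|P20] := eqVneq P2 0; first by rewrite size_poly0.
  by move: sP1; rewrite P12 mulrC size_mulX.
have sQ1 : (size Q1 <= d.+1)%N.
  apply/leq_sizeP => j; rewrite leq_eqVlt => /predU1P[<-|dj].
    by rewrite !coefE.
  by rewrite !coefE !nth_default ?mulr0 ?addr0 // (leq_trans _ dj).
(* Dividing [P1] by ['X] keeps the normalization, since [w] times the conjugate of [cinv w] is 1. *)
have PQ2 w : w != 0 -> P2.[w] * (P2.[cinv w])^* + Q1.[w] * (Q1.[cinv w])^* = 1.
  move=> w0; rewrite -(PQ1 w w0) -[RHS]mul1r -xy.
  have -> : P2.[w] * (P2.[cinv w])^* = P1.[w] * (P1.[cinv w])^*.
    by rewrite P12 !hornerE rmorphM /= conj_cinv; field.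
  rewrite /P1 /Q1 !hornerE !rmorphD !rmorphM /= rmorphN /= !conjCK; ring.
have [R0 [Rs [uR0 uRs sRs RsE]]] := IH P2 Q1 sP2 sQ1 PQ2.
exists R0, (mx2 x^* (- y) y^* x :: Rs); split => //=; last 1 first.
- by rewrite RsE !mxE /= -P12 scaleNr -PE -QE.
- constructor => //; apply: unitary_mx2; rewrite ?rmorphN /= ?conjCK -?xy; ring.
- by rewrite sRs.
Qed.
End SignalProcessing.

(** * Tensor products and gates *)

Lemma bit0 x : bit 0 x = odd x.
Proof. by rewrite /bit expn0 divn1. Qed.

Lemma bitS q x : bit q.+1 x = bit q x./2.
Proof. by rewrite /bit expnS -divn2 divnMA. Qed.

Lemma bit_inj n x y : (x < 2 ^ n)%N -> (y < 2 ^ n)%N ->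
  (forall q, (q < n)%N -> bit q x = bit q y) -> x = y.
Proof.
elim: n x y => [|n IH] x y; first by rewrite expn0 !ltnS !leqn0 => /eqP -> /eqP ->.
rewrite expnS => xn yn xy.
rewrite -(odd_double_half x) -(odd_double_half y) -!bit0 xy //; congr (_ + _.*2)%N.
apply: IH => [||q qn]; [lia | lia |].
by rewrite -!bitS xy.
Qed.

Lemma ord_bit_inj n (x y : 'I_(2 ^ n)) : (forall q : 'I_n, bit q x = bit q y) -> x = y.
Proof.
move=> xy; apply: val_inj; apply: (bit_inj (ltn_ord x) (ltn_ord y)) => q qn.
exact: (xy (Ordinal qn)).
Qed.

Lemma b2o_inj : injective b2o.
Proof. by move=> [] []. Qed.

Section Gates.
Variable R : realType.
Local Notation C := (R[i]).

(** With basis states read as bit assignments, the sum in a matrix product factors qubit by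
    qubit. *)
Lemma sum_bits n (G : {ffun 'I_n -> bool} -> C) :
  \sum_(y < 2 ^ n) G [ffun q : 'I_n => bit q y] = \sum_f G f.
Proof.
have inj : injective (fun y : 'I_(2 ^ n) => [ffun q : 'I_n => bit q y]).
  by move=> x y /ffunP xy; apply: ord_bit_inj => q; have := xy q; rewrite !ffunE.
rewrite [RHS](reindex (fun y : 'I_(2 ^ n) => [ffun q : 'I_n => bit q y])) //.
apply: onW_bij; apply: inj_card_bij => //.
by rewrite card_ffun card_bool !card_ord.
Qed.

Lemma sum_ord2 (G : 'I_2 -> C) : \sum_i G i = \sum_(b : bool) G (b2o b).
Proof. by rewrite big_bool /= big_ord_recl big_ord1 addrC; congr (G _ + G _); apply/val_inj. Qed.

Section Tens.
Variable n : nat.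
Implicit Types (F G : 'I_n -> 'M[C]_2) (q j : 'I_n) (u v : 'M[C]_2).

(** Pauli strings, one-qubit gates and control projections all have this shape, so their products
    and commutations reduce to 2 x 2 matrices. *)
Definition tens F : 'M[C]_(2 ^ n) :=
  \matrix_(x, y) \prod_(q < n) F q (b2o (bit q x)) (b2o (bit q y)).

Lemma eq_tens F G : F =1 G -> tens F = tens G.
Proof. by move=> FG; apply/matrixP => x y; rewrite !mxE; apply: eq_bigr => q _; rewrite FG. Qed.

Lemma tensM F G : tens F *m tens G = tens (fun q => F q *m G q).
Proof.
apply/matrixP => x z; rewrite !mxE.
pose h q b := F q (b2o (bit q x)) (b2o b) * G q (b2o b) (b2o (bit q z)).
transitivity (\sum_(y < 2 ^ n) \prod_(q < n) h q ([ffun q : 'I_n => bit q y] q)).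
  by apply: eq_bigr => y _; rewrite !mxE -big_split; apply: eq_bigr => q _; rewrite ffunE.
rewrite (sum_bits (fun f => \prod_(q < n) h q (f q))) -bigA_distr_bigA.
by apply: eq_bigr => q _; rewrite mxE sum_ord2.
Qed.

Lemma prod_bits_eq (x y : 'I_(2 ^ n)) :
  \prod_(q < n) (bit q x == bit q y)%:R = (x == y)%:R :> C.
Proof.
have [<-|xy] := eqVneq x y; first by rewrite big1 // => q _; rewrite eqxx.
have [q] : exists q : 'I_n, bit q x != bit q y.
  apply/existsP; apply: contraNT xy => /existsPn h.
  by apply/eqP/ord_bit_inj => q; have /negPn/eqP := h q.
by move=> /negbTE h; rewrite (bigD1 q) //= h mul0r.
Qed.

Lemma tens1 : tens (fun=> 1%:M) = 1%:M.
Proof.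
apply/matrixP => x y; rewrite !mxE -prod_bits_eq.
by apply: eq_bigr => q _; rewrite mxE (inj_eq b2o_inj).
Qed.

Lemma tens_comm F G : (forall q, F q *m G q = G q *m F q) ->
  tens F *m tens G = tens G *m tens F.
Proof. by move=> FG; rewrite !tensM; apply: eq_tens. Qed.

Lemma one_qubit_tens j u :
  one_qubit_mx j u = tens (fun q => if q == j then u else 1%:M).
Proof.
apply/matrixP => x y; rewrite !mxE (bigD1 j) //= eqxx.
rewrite (eq_bigr (fun q : 'I_n => (bit q x == bit q y)%:R)); last first.
  by move=> q /negbTE ->; rewrite mxE (inj_eq b2o_inj).
case: ifPn => [/forallP h|/forallPn[q]].
  by rewrite big1 ?mulr1 // => q qj; have := h q; rewrite qj => /eqP ->; rewrite eqxx.
by rewrite negb_imply => /andP[qj /negbTE h]; rewrite (bigD1 q) //= h mul0r mulr0.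
Qed.

Lemma one_qubitM j u v : one_qubit_mx j u *m one_qubit_mx j v = one_qubit_mx j (u *m v).
Proof.
by rewrite !one_qubit_tens tensM; apply: eq_tens => q; case: eqP; rewrite ?mulmx1.
Qed.

Lemma one_qubit1 j : one_qubit_mx j 1%:M = 1%:M :> 'M[C]_(2 ^ n).
Proof. by rewrite one_qubit_tens -tens1; apply: eq_tens => q; rewrite if_same. Qed.

Lemma one_qubitD j u v : one_qubit_mx j (u + v) = one_qubit_mx j u + one_qubit_mx j v.
Proof. by apply/matrixP => x y; rewrite !mxE; case: ifP; rewrite ?addr0 // mxE. Qed.

Lemma one_qubitZ j a u : one_qubit_mx j (a *: u) = a *: one_qubit_mx j u.
Proof. by apply/matrixP => x y; rewrite !mxE; case: ifP; rewrite ?mulr0 // mxE. Qed.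

Lemma tens_one_qubit_comm F j u : F j *m u = u *m F j ->
  tens F *m one_qubit_mx j u = one_qubit_mx j u *m tens F.
Proof.
by move=> Fu; rewrite one_qubit_tens; apply: tens_comm => q; case: eqP => [->|_];
  rewrite ?mulmx1 ?mul1mx.
Qed.

Lemma one_qubitC j k u v : j != k ->
  one_qubit_mx j u *m one_qubit_mx k v = one_qubit_mx k v *m one_qubit_mx j u.
Proof.
move=> jk; rewrite one_qubit_tens tens_one_qubit_comm // eq_sym (negbTE jk).
by rewrite mulmx1 mul1mx.
Qed.

Definition proj (b : bool) : 'M[C]_2 := delta_mx (b2o b) (b2o b).

Lemma proj_id b : proj b *m proj b = proj b.
Proof. by rewrite /proj mul_delta_mx. Qed.

Lemma proj_orth b : proj b *m proj (~~ b) = 0.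
Proof. by rewrite /proj mul_delta_mx_0 //; case: b. Qed.

Lemma proj_sum b : proj b + proj (~~ b) = 1%:M.
Proof.
apply/matrixP => i j; rewrite !mxE.
by case: b; case: i => [[|[]]] // ?; case: j => [[|[]]] // ?; rewrite /= ?addr0 ?add0r.
Qed.

Definition ctl_factor (c : {ffun 'I_n -> option bool}) q : 'M[C]_2 :=
  if c q is Some b then proj b else 1%:M.
Definition ctl c := tens (ctl_factor c).

Lemma ctlE c x y : ctl c x y = ((x == y) && ctrl_ok c x)%:R.
Proof.
rewrite mxE; have [<-|xy] := eqVneq x y; last first.
  rewrite /=; have [q] : exists q : 'I_n, bit q x != bit q y.
    apply/existsP; apply: contraNT xy => /existsPn h.
    by apply/eqP/ord_bit_inj => q; have /negPn/eqP := h q.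
  move=> h; rewrite (bigD1 q) //= /ctl_factor.
  case: (c q) => [b|]; rewrite mxE ?(inj_eq b2o_inj) ?(negbTE h) ?mul0r //.
  by move: h; case: bit; case: bit; case: b; rewrite //= mul0r.
rewrite /=; have [/forallP h|/forallPn[q h]] := boolP (ctrl_ok c x).
  rewrite big1 // => q _; have := h q; rewrite /ctl_factor.
  by case: (c q) => [b /eqP ->|_]; rewrite mxE !eqxx.
rewrite (bigD1 q) //= /ctl_factor; case: (c q) h => // b h.
by rewrite mxE (inj_eq b2o_inj) (negbTE h) mul0r.
Qed.

Lemma ctl_id c : ctl c *m ctl c = ctl c.
Proof.
by rewrite tensM; apply: eq_tens => q; rewrite /ctl_factor; case: (c q) => [b|];
  rewrite ?mulmx1 ?proj_id.
Qed.

(** Trades the case distinction on entries for projection algebra, where commutation with operators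
    on other qubits can be used. *)
Lemma gate_mxE (g : gate R n) :
  gate_mx g = ctl (g_ctrl g) *m base_mx (g_base g) *m ctl (g_ctrl g)
              + (1%:M - ctl (g_ctrl g)).
Proof.
have mul_ctl c (M : 'M[C]_(2 ^ n)) x y : (ctl c *m M) x y = (ctrl_ok c x)%:R * M x y.
  rewrite mxE (bigD1 x) //= ctlE eqxx big1 ?addr0 // => z zx.
  by rewrite ctlE eq_sym (negbTE zx) mul0r.
have ctl_mul c (M : 'M[C]_(2 ^ n)) x y : (M *m ctl c) x y = M x y * (ctrl_ok c y)%:R.
  rewrite mxE (bigD1 y) //= ctlE eqxx big1 ?addr0 // => z zx.
  by rewrite ctlE (negbTE zx) mulr0.
have sub_ctl c x y : (1%:M - ctl c) x y = (x == y)%:R - ctl c x y.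
  by rewrite mxE; congr (_ + _); rewrite mxE.
apply/matrixP => x y; rewrite [RHS]mxE ctl_mul mul_ctl sub_ctl ctlE mxE.
case: eqVneq => [<-|xy]; [case: (ctrl_ok (g_ctrl g) x)
  | case: (ctrl_ok (g_ctrl g) x); case: (ctrl_ok (g_ctrl g) y)];
  by rewrite /= ?(mul1r, mul0r, mulr1, mulr0, subrr, subr0, addr0, add0r).
Qed.

Definition base_free_of q (b : base_gate R n) : Prop :=
  match b with BUnitary j _ => j != q | BPauli P => P q = 0 end.

Definition free_of q (g : gate R n) : Prop :=
  g_ctrl g q = None /\ base_free_of q (g_base g).

Lemma ctl_comm q u (c : {ffun 'I_n -> option bool}) : c q = None ->
  ctl c *m one_qubit_mx q u = one_qubit_mx q u *m ctl c.
Proof. by move=> cq; rewrite tens_one_qubit_comm // /ctl_factor cq mulmx1 mul1mx. Qed.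

Lemma sigma0 : sigma R 0 = 1%:M. Proof. by []. Qed.

Lemma base_comm q u (b : base_gate R n) : base_free_of q b ->
  base_mx b *m one_qubit_mx q u = one_qubit_mx q u *m base_mx b.
Proof.
case: b => [j v jq|P Pq] /=; first exact: one_qubitC.
by rewrite [pauli_mx R P](_ : _ = tens (fun q => sigma R (P q))) // tens_one_qubit_comm // Pq
  sigma0 mulmx1 mul1mx.
Qed.

Lemma gate_comm q u g : free_of q g ->
  gate_mx g *m one_qubit_mx q u = one_qubit_mx q u *m gate_mx g.
Proof.
case=> gq bq; rewrite gate_mxE mulmxDl mulmxDr mulmxBl mulmxBr mul1mx mulmx1 ctl_comm //.
congr (_ + _).
by rewrite -mulmxA ctl_comm // mulmxA -(mulmxA (ctl _)) base_comm // !mulmxA ctl_comm.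
Qed.

Definition add_ctrl q b (g : gate R n) : gate R n :=
  Gate [ffun q' => if q' == q then Some b else g_ctrl g q'] (g_base g).

(** The new control multiplies the projection [ctl] by that of qubit [q], which commutes with the
    old controls and with the base gate because neither touches [q]. *)
Lemma gate_add_ctrl q b g : free_of q g ->
  gate_mx (add_ctrl q b g) =
  one_qubit_mx q (proj b) *m gate_mx g + one_qubit_mx q (proj (~~ b)).
Proof.
move=> /[dup] fg [gq bq]; rewrite !gate_mxE /=.
set c' := [ffun _ => _]; set c := g_ctrl g; set B := base_mx _.
have cE : ctl c' = one_qubit_mx q (proj b) *m ctl c.
  rewrite one_qubit_tens tensM; apply: eq_tens => j; rewrite /ctl_factor ffunE.
  by case: eqP => [->|_]; rewrite ?gq ?mulmx1 ?mul1mx.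
have -> : one_qubit_mx q (proj (~~ b)) = 1%:M - one_qubit_mx q (proj b).
  by rewrite -(one_qubit1 q) -(proj_sum b) one_qubitD addrC addKr.
set e := one_qubit_mx q (proj b) in cE *.
have ee : e *m e = e by rewrite one_qubitM proj_id.
have ce : ctl c *m e = e *m ctl c by apply: ctl_comm.
have Be : B *m e = e *m B by apply: base_comm.
rewrite mulmxDr mulmxBr mulmx1 -addrA; congr (_ + _).
  by rewrite cE !mulmxA -(mulmxA _ B e) Be mulmxA -(mulmxA e (ctl c) e) ce mulmxA ee.
by rewrite cE [RHS]addrC addrA subrK.
Qed.

End Tens.
End Gates.

(** * Circuits *)

Section Circuits.
Variables (R : realType) (n : nat).
Local Notation C := (R[i]).
Implicit Types (c : circuit R n) (g : gate R n) (q j : 'I_n) (u v : 'M[C]_2).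

Lemma circuit_mx_cons g c : circuit_mx (g :: c) = circuit_mx c *m gate_mx g.
Proof.
have foldlE (M : 'M[C]_(2 ^ n)) d :
    foldl (fun (M : 'M[C]_(2 ^ n)) g => gate_mx g *m M) M d = circuit_mx d *m M.
  rewrite /circuit_mx; elim: d M => [|h d IH] M /=; first by rewrite mul1mx.
  by rewrite IH [in RHS]IH mulmx1 mulmxA.
by rewrite /circuit_mx /= foldlE mulmx1.
Qed.

Lemma circuit_mx_nil : circuit_mx ([::] : circuit R n) = 1%:M. Proof. by []. Qed.

Lemma circuit_mx_cat c1 c2 : circuit_mx (c1 ++ c2) = circuit_mx c2 *m circuit_mx c1.
Proof.
elim: c1 => [|g c1 IH] /=; first by rewrite circuit_mx_nil mulmx1.
by rewrite !circuit_mx_cons IH mulmxA.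
Qed.

Lemma circuit_wfP c : List.Forall (@gate_wf R n) c -> circuit_wf c.
Proof.
elim=> [|g d wg _ IH] [|i] //= id; exact: IH.
Qed.

Lemma circuit_cost_cat c1 c2 :
  circuit_cost (c1 ++ c2) = (circuit_cost c1 + circuit_cost c2)%N.
Proof. exact: big_cat. Qed.

Lemma circuit_cost_cons g c : circuit_cost (g :: c) = (gate_cost g + circuit_cost c)%N.
Proof. exact: big_cons. Qed.

Lemma circuit_comm q u c : List.Forall (free_of q) c ->
  circuit_mx c *m one_qubit_mx q u = one_qubit_mx q u *m circuit_mx c.
Proof.
elim=> [|g d fg _ IH]; first by rewrite circuit_mx_nil mulmx1 mul1mx.
by rewrite !circuit_mx_cons -mulmxA gate_comm // mulmxA IH mulmxA.
Qed.

(** Every gate preserves the value of [q], so the cross terms of the product contain two orthogonal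
    projections and vanish. *)
Lemma circuit_add_ctrl q b c : List.Forall (free_of q) c ->
  circuit_mx (map (add_ctrl q b) c) =
  one_qubit_mx q (proj R b) *m circuit_mx c + one_qubit_mx q (proj R (~~ b)).
Proof.
elim=> [|g d fg fd IH] /=.
  by rewrite !circuit_mx_nil mulmx1 -one_qubitD proj_sum one_qubit1.
rewrite !circuit_mx_cons IH gate_add_ctrl // !mulmxDl !mulmxDr.
set e := one_qubit_mx q (proj R b); set e' := one_qubit_mx q _.
have e'e : e' *m e = 0.
  by rewrite one_qubitM -{2}[b]negbK proj_orth -(scale0r 0) one_qubitZ scale0r.
have ee' : e *m e' = 0 by rewrite one_qubitM proj_orth -(scale0r 0) one_qubitZ scale0r.
have -> : e *m circuit_mx d *m (e *m gate_mx g) = e *m (circuit_mx d *m gate_mx g).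
  by rewrite mulmxA -(mulmxA e) circuit_comm // !mulmxA one_qubitM proj_id.
have -> : e *m circuit_mx d *m e' = 0.
  by rewrite -mulmxA circuit_comm // mulmxA ee' mul0mx.
have -> : e' *m (e *m gate_mx g) = 0 by rewrite mulmxA e'e mul0mx.
by rewrite one_qubitM proj_id ?addr0 ?add0r.
Qed.

Lemma gate_wf_add_ctrl q b g : gate_wf g -> free_of q g -> gate_wf (add_ctrl q b g).
Proof.
rewrite /gate_wf /free_of /=; case: (g_base g) => [j u|P] /=.
  by move=> [uu gj] [gq jq]; split => //; rewrite ffunE (negbTE jq).
move=> h [gq Pq] k; rewrite ffunE; case: (k =P q) => [->|_] //; exact: h.
Qed.

Lemma gate_cost_add_ctrl q b g : (gate_cost (add_ctrl q b g) <= (gate_cost g).+1)%N.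
Proof.
rewrite /gate_cost /= !add1n ltnS.
apply: (@leq_trans #|q |: [set j | g_ctrl g j != None]|).
  apply/subset_leq_card/fintype.subsetP => j; rewrite !inE ffunE.
  by case: (j =P q).
by rewrite cardsU1 -add1n leq_add2r leq_b1.
Qed.

Lemma circuit_cost_add_ctrl q b c :
  (circuit_cost (map (add_ctrl q b) c) <= circuit_cost c + size c)%N.
Proof.
elim: c => [|g c IH]; first by rewrite /circuit_cost big_nil.
rewrite [map _ _]/= !circuit_cost_cons.
apply: leq_trans (leq_add (gate_cost_add_ctrl q b g) IH) _.
by rewrite [size (_ :: _)]/=; lia.
Qed.

Lemma wf_add_ctrl q b c : List.Forall (@gate_wf R n) c -> List.Forall (free_of q) c ->
  List.Forall (@gate_wf R n) (map (add_ctrl q b) c).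
Proof.
elim=> [|g d wg _ IH] fc //=; inversion fc as [|? ? fg fd]; constructor; last exact: IH.
exact: gate_wf_add_ctrl.
Qed.

Lemma free_add_ctrl q j b c : j != q -> List.Forall (free_of j) c ->
  List.Forall (free_of j) (map (add_ctrl q b) c).
Proof.
move=> jq; elim=> [|g d [gj bj] _ IH] //=; constructor => //; split => //.
by rewrite /= ffunE (negbTE jq).
Qed.

Lemma ForallP_cat (T : Type) (P : T -> Prop) (s1 s2 : seq T) :
  List.Forall P s1 -> List.Forall P s2 -> List.Forall P (s1 ++ s2).
Proof. by elim=> [|x s px _ IH] //= /IH; constructor. Qed.

End Circuits.

(** * Linear combinations of Pauli strings *)

Section CombinationOfPaulis.
Variables (R : realType) (n : nat).
Local Notation C := (R[i]).
Local Notation o := (@one_qubit_mx R n).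
Implicit Types (q e l : 'I_n) (ls : seq 'I_n) (u v : 'M[C]_2) (f : nat -> pstring n * R).

Lemma mx2M (a b c d a' b' c' d' : C) : mx2 a b c d *m mx2 a' b' c' d' =
  mx2 (a * a' + b * c') (a * b' + b * d') (c * a' + d * c') (c * b' + d * d').
Proof.
apply/matrixP => i j; rewrite !mxE big_ord_recl big_ord1 !mxE.
by case: i => [[|[]]] // ?; case: j => [[|[]]] // ?.
Qed.

Lemma mx2_1 : mx2 1 0 0 1 = 1%:M :> 'M[C]_2.
Proof.
by apply/matrixP => i j; rewrite !mxE; case: i => [[|[]]] // ?; case: j => [[|[]]].
Qed.

Lemma mx2_proj0 : proj R false = mx2 1 0 0 0.
Proof.
by apply/matrixP => i j; rewrite !mxE; case: i => [[|[]]] // ?; case: j => [[|[]]].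
Qed.

Lemma mx2_proj1 : proj R true = mx2 0 0 0 1.
Proof.
by apply/matrixP => i j; rewrite !mxE; case: i => [[|[]]] // ?; case: j => [[|[]]].
Qed.

Lemma mx2Z (x a b c d : C) : x *: mx2 a b c d = mx2 (x * a) (x * b) (x * c) (x * d).
Proof.
by apply/matrixP => i j; rewrite !mxE; case: i => [[|[]]] // ?; case: j => [[|[]]].
Qed.

(** A unitary involution whose corner entry is the prescribed weight. That it is its own inverse is
    what makes the whole [lcu] circuit an involution. *)
Definition reflection (r : R) : 'M[C]_2 :=
  mx2 r%:C%C (Num.sqrt (1 - r ^+ 2))%:C%C (Num.sqrt (1 - r ^+ 2))%:C%C (- r%:C%C).

Lemma conjCR (x : R) : (x%:C%C)^* = x%:C%C :> C.
Proof. exact: conjc_real. Qed.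

Lemma reflection_sqr (r : R) : `|r| <= 1 ->
  r%:C%C * r%:C%C + (Num.sqrt (1 - r ^+ 2))%:C%C * (Num.sqrt (1 - r ^+ 2))%:C%C = 1 :> C.
Proof.
move=> r1; have h : r * r + Num.sqrt (1 - r ^+ 2) * Num.sqrt (1 - r ^+ 2) = 1.
  rewrite -!expr2 sqr_sqrtr ?subrKC // subr_ge0 -real_normK ?num_real //.
  by rewrite expr_le1.
by move/(congr1 (real_complex R)): h; rewrite rmorphD !rmorphM rmorph1.
Qed.

Lemma reflection_id r : `|r| <= 1 -> reflection r *m reflection r = 1%:M.
Proof.
move=> /reflection_sqr r1; rewrite mx2M -mx2_1; congr mx2; rewrite -?r1; ring.
Qed.

Lemma reflection_unitary r : `|r| <= 1 -> unitary (reflection r).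
Proof.
by move=> /reflection_sqr r1; apply: unitary_mx2; rewrite ?rmorphN /= ?conjCR -?r1; ring.
Qed.

Lemma reflection_corner r : proj R false *m reflection r *m proj R false = r%:C%C *: proj R false.
Proof. by rewrite mx2_proj0 !mx2M mx2Z; congr mx2; ring. Qed.

Definition hadamard := reflection (Num.sqrt 2^-1).

Lemma hadamard_norm : `|Num.sqrt 2^-1 : R| <= 1.
Proof.
by rewrite ger0_norm ?sqrtr_ge0 // -[leRHS]sqrtr1 ler_sqrt // invf_le1 // ler1n.
Qed.

(** Each label value is entered and left with an amplitude of modulus 1 / sqrt 2, so each branch
    contributes one half. *)
Lemma hadamard_corner b :
  proj R false *m hadamard *m proj R b *m hadamard *m proj R false = 2^-1 *: proj R false.
Proof.
have h2 : (Num.sqrt 2^-1)%:C%C * (Num.sqrt 2^-1)%:C%C = 2^-1 :> C.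
  rewrite -(rmorphM (real_complex R)) /= -expr2 sqr_sqrtr ?invr_ge0 //.
  by rewrite fmorphV rmorph_nat.
have s2 : (Num.sqrt (1 - Num.sqrt 2^-1 ^+ 2))%:C%C * (Num.sqrt (1 - Num.sqrt 2^-1 ^+ 2))%:C%C
     = 2^-1 :> C.
  by apply: (addrI (2^-1 : C)); rewrite -{1}h2 (reflection_sqr hadamard_norm); field.
case: b; rewrite /hadamard /reflection ?mx2_proj1 mx2_proj0 !mx2M mx2Z.
  by congr mx2; rewrite ?(mulr0, mul0r, addr0, add0r, mulr1, mul1r) ?s2.
by congr mx2; rewrite ?(mulr0, mul0r, addr0, add0r, mulr1, mul1r) ?h2.
Qed.

Definition plain (b : base_gate R n) : gate R n := Gate [ffun=> None] b.

Lemma plain_mx b : gate_mx (plain b) = base_mx b.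
Proof.
rewrite gate_mxE /=; have -> : ctl R [ffun=> None] = 1%:M :> 'M[C]_(2 ^ n).
  by rewrite -tens1; apply: eq_tens => q; rewrite /ctl_factor ffunE.
by rewrite mul1mx mulmx1 subrr addr0.
Qed.

Lemma plain_cost b : gate_cost (plain b) = 1%N.
Proof.
rewrite /gate_cost /=; suff -> : [set q | [ffun=> None] q != None :> option bool] =
    finset.set0 :> {set 'I_n}.
  by rewrite cards0.
by apply/setP => q; rewrite !inE ffunE.
Qed.

Definition ctrl0 ls : {ffun 'I_n -> option bool} :=
  [ffun q => if q \in ls then Some false else None].
Definition zeros ls : 'M[C]_(2 ^ n) := ctl R (ctrl0 ls).

Lemma zeros_nil : zeros [::] = 1%:M.
Proof. by rewrite -tens1; apply: eq_tens => q; rewrite /ctl_factor ffunE. Qed.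

Lemma zeros_cons l ls : l \notin ls -> zeros (l :: ls) = o l (proj R false) *m zeros ls.
Proof.
move=> lls; rewrite one_qubit_tens tensM; apply: eq_tens => q.
rewrite /ctl_factor !ffunE inE; case: eqP => [->|_] /=; last by rewrite mul1mx.
by rewrite (negbTE lls) mulmx1.
Qed.

Lemma zeros_id ls : zeros ls *m zeros ls = zeros ls.
Proof. exact: ctl_id. Qed.

Lemma zeros_comm q u ls : q \notin ls -> zeros ls *m o q u = o q u *m zeros ls.
Proof. by move=> qls; apply: ctl_comm; rewrite ffunE (negbTE qls). Qed.

(* Block-encodes the average of the operators [r_i P_i] over [i < 2 ^ size ls]: qubit [e] carries
   the weights [r_i], the qubits [ls] the binary label [i]. *)
Fixpoint lcu e ls (f : nat -> pstring n * R) : circuit R n :=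
  if ls is l :: ls' then
    plain (BUnitary l hadamard) ::
      map (add_ctrl l false) (lcu e ls' f) ++
      map (add_ctrl l true) (lcu e ls' (fun i => f (2 ^ size ls' + i)%N)) ++
      [:: plain (BUnitary l hadamard)]
  else [:: plain (BUnitary e (reflection (f 0%N).2)); plain (BPauli R (f 0%N).1)].

Lemma plain_free q b : base_free_of q b -> free_of q (plain b).
Proof. by move=> h; split; rewrite // ffunE. Qed.

Lemma lcu_free q e ls f : q \notin e :: ls -> (forall i, (f i).1 q = 0) ->
  List.Forall (free_of q) (lcu e ls f).
Proof.
elim: ls f => [|l ls IH] f; rewrite !inE ?negb_or.
  move=> qe fq; constructor; first by apply: plain_free; rewrite /= eq_sym.
  by constructor => //; apply: plain_free => /=.
move=> /and3P[qe ql qls] fq /=; have qn : q \notin e :: ls by rewrite inE negb_or qe.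
have pq : free_of q (plain (BUnitary l hadamard)) by apply: plain_free; rewrite /= eq_sym.
constructor => //; apply: ForallP_cat; first by apply: free_add_ctrl => //; exact: IH.
by apply: ForallP_cat; [apply: free_add_ctrl => //; exact: IH | constructor].
Qed.

Definition lcu_ok e ls (f : nat -> pstring n * R) :=
  uniq (e :: ls) /\ forall i, `|(f i).2| <= 1 /\ forall q, q \in e :: ls -> (f i).1 q = 0.

(** The offset [k] will be 0 for the lower half of the labels and [2 ^ size ls] for the upper
    half. *)
Lemma lcu_ok_cons e l ls f k : lcu_ok e (l :: ls) f ->
  [/\ lcu_ok e ls (fun i => f (k + i)%N), l != e, l \notin ls &
   List.Forall (free_of l) (lcu e ls (fun i => f (k + i)%N))].
Proof.
move=> [] /=; rewrite inE negb_or => /and3P[/andP[el els] lls uls] fok.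
have le : l != e by rewrite eq_sym.
split => //.
  split=> [|i]; first by rewrite /= els.
  have [f1 f2] := fok (k + i)%N; split => // q; rewrite inE => qe; apply: f2.
  by rewrite !inE; case/orP: qe => ->; rewrite ?orbT.
apply: lcu_free; first by rewrite inE negb_or le.
by move=> i; apply: (fok (k + i)%N).2; rewrite !inE eqxx orbT.
Qed.

Lemma lcu_wf e ls f : lcu_ok e ls f -> List.Forall (@gate_wf R n) (lcu e ls f).
Proof.
elim: ls f => [|l ls IH] f.
  move=> [_ /(_ 0%N)[f1 _]]; constructor.
    by split; [exact: reflection_unitary | rewrite ffunE].
  by constructor => // q; rewrite ffunE.
move=> fok; have [ok1 _ _ fr1] := lcu_ok_cons 0 fok.
have [ok2 _ _ fr2] := lcu_ok_cons (2 ^ size ls) fok.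
have wh : gate_wf (plain (BUnitary l hadamard)).
  by split; [apply: reflection_unitary hadamard_norm | rewrite ffunE].
constructor => //; apply: ForallP_cat; first by apply: wf_add_ctrl => //; exact: IH.
by apply: ForallP_cat; [apply: wf_add_ctrl => //; exact: IH | constructor].
Qed.

Lemma lcu_cons e l ls f : lcu e (l :: ls) f =
  plain (BUnitary l hadamard) :: map (add_ctrl l false) (lcu e ls f) ++
  map (add_ctrl l true) (lcu e ls (fun i => f (2 ^ size ls + i)%N)) ++
  [:: plain (BUnitary l hadamard)].
Proof. by []. Qed.

(** The two controlled halves act on complementary values of [l], so their product is a block sum,
    conjugated by Hadamard gates. *)
Lemma lcu_mx_cons e l ls f : lcu_ok e (l :: ls) f ->
  circuit_mx (lcu e (l :: ls) f) = o l hadamard *m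
   (o l (proj R false) *m circuit_mx (lcu e ls f) +
    o l (proj R true) *m circuit_mx (lcu e ls (fun i => f (2 ^ size ls + i)%N))) *m o l hadamard.
Proof.
move=> fok; have [_ _ _ fr1] := lcu_ok_cons 0 fok.
have [_ _ _ fr2] := lcu_ok_cons (2 ^ size ls) fok.
rewrite lcu_cons circuit_mx_cons !circuit_mx_cat circuit_mx_cons circuit_mx_nil mul1mx plain_mx.
congr (_ *m _); rewrite -mulmxA; congr (_ *m _).
rewrite !circuit_add_ctrl // mulmxDl !mulmxDr.
set A := circuit_mx (lcu e ls f); set B := circuit_mx (lcu _ _ _).
rewrite [~~ true]/= [~~ false]/=.
have oz : o l 0 = 0 by rewrite -(scale0r 0) one_qubitZ scale0r.
have Bc u : B *m o l u = o l u *m B by apply: circuit_comm.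
have -> : o l (proj R true) *m B *m (o l (proj R false) *m A) = 0.
  by rewrite mulmxA -(mulmxA _ B) Bc mulmxA one_qubitM (proj_orth R true) oz !mul0mx.
have -> : o l (proj R true) *m B *m o l (proj R true) = o l (proj R true) *m B.
  by rewrite -mulmxA Bc mulmxA one_qubitM proj_id.
rewrite mulmxA !one_qubitM proj_id (proj_orth R false) oz addr0 add0r.
by rewrite addrC.
Qed.

Lemma pauli_sqr (P : pstring n) : pauli_mx R P *m pauli_mx R P = 1%:M.
Proof.
rewrite (@tensM R n (fun q => sigma R (P q)) (fun q => sigma R (P q))) -tens1.
apply: eq_tens => q; apply/matrixP => i j; rewrite !mxE big_ord_recl big_ord1 /sigma.
case: (P q) => [[|[|[|[|]]]]] // ?; rewrite /= !mxE;
  case: i => [[|[]]] // ?; case: j => [[|[]]] // ? /=;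
  by rewrite ?(mulr0, mul0r, addr0, add0r, mulr1, mulrNN) //;
  apply/eqP; rewrite eq_complex /= ?(mulr0, mul0r, addr0, add0r, mulr1, mulrN1, mulrNN)
    ?(subr0, sub0r, opprK, oppr0, eqxx).
Qed.

Lemma pauli_one_qubit (P : pstring n) q u : P q = 0 ->
  pauli_mx R P *m o q u = o q u *m pauli_mx R P.
Proof. exact: (@base_comm R n q u (BPauli R P)). Qed.

(** A block sum of involutions conjugated by an involution is again one; at the bottom, reflection
    and Pauli string commute because the string is the identity on [e]. This gives the walk an
    explicit inverse circuit. *)
Lemma lcu_sqr e ls f : lcu_ok e ls f ->
  circuit_mx (lcu e ls f) *m circuit_mx (lcu e ls f) = 1%:M.
Proof.
elim: ls f => [|l ls IH] f fok.
  have [_ /(_ 0%N)[f1 f2]] := fok; have {}f2 := f2 e (mem_head _ _).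
  rewrite !circuit_mx_cons circuit_mx_nil mul1mx !plain_mx /= -mulmxA.
  rewrite (mulmxA (o _ _)) -pauli_one_qubit // -mulmxA one_qubitM reflection_id //.
  by rewrite one_qubit1 mulmx1 pauli_sqr.
have [ok1 _ _ fr1] := lcu_ok_cons 0 fok.
have [ok2 _ _ fr2] := lcu_ok_cons (2 ^ size ls) fok.
rewrite lcu_mx_cons //; have {IH} := (IH _ ok1, IH _ ok2).
set A := circuit_mx _; set B := circuit_mx (lcu e ls _) => -[AA BB].
have oz : o l 0 = 0 by rewrite -(scale0r 0) one_qubitZ scale0r.
have Ac u : A *m o l u = o l u *m A by apply: circuit_comm.
have Bc u : B *m o l u = o l u *m B by apply: circuit_comm.
set M := _ + _; have MM : M *m M = 1%:M.
  rewrite /M mulmxDl !mulmxDr !mulmxA -!(mulmxA _ A (o _ _)) -!(mulmxA _ B (o _ _)) !Ac !Bc.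
  rewrite !mulmxA !one_qubitM !proj_id (proj_orth R false) (proj_orth R true) oz !mul0mx.
  rewrite addr0 add0r -!mulmxA AA BB !mulmx1 -one_qubitD (proj_sum R false).
  exact: one_qubit1.
have hh : o l hadamard *m o l hadamard = 1%:M.
  by rewrite one_qubitM (reflection_id hadamard_norm) one_qubit1.
rewrite -!mulmxA (mulmxA (o l hadamard) (o l hadamard)) hh mul1mx (mulmxA M M) MM mul1mx.
exact: hh.
Qed.

Definition pauli_average k (f : nat -> pstring n * R) : 'M[C]_(2 ^ n) :=
  (2 ^- k) *: \sum_(i < 2 ^ k) (f i).2%:C%C *: pauli_mx R (f i).1.

Lemma pauli_averageS k f : pauli_average k.+1 f =
  2^-1 *: (pauli_average k f + pauli_average k (fun i => f (2 ^ k + i)%N)).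
Proof.
rewrite /pauli_average -scalerDr scalerA -invfM -exprS; congr (_ *: _).
by rewrite expnS mul2n -addnn big_split_ord.
Qed.

Lemma lcu_corner e ls f : lcu_ok e ls f ->
  zeros (e :: ls) *m circuit_mx (lcu e ls f) *m zeros (e :: ls) =
  zeros (e :: ls) *m pauli_average (size ls) f.
Proof.
elim: ls f => [|l ls IH] f fok.
  have [_ /(_ 0%N)[f1 f2]] := fok; have {}f2 := f2 e (mem_head _ _).
  rewrite zeros_cons // zeros_nil mulmx1 !circuit_mx_cons circuit_mx_nil mul1mx !plain_mx /=.
  rewrite /pauli_average expr0 invr1 scale1r big_ord1 -(mulmxA _ _ (o _ _)).
  rewrite -(mulmxA (pauli_mx _ _)) one_qubitM pauli_one_qubit // mulmxA one_qubitM.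
  by rewrite mulmxA reflection_corner one_qubitZ -scalemxAl -scalemxAr.
have [ok1' le lls fr1] := lcu_ok_cons 0 fok.
have ok1 : lcu_ok e ls f := ok1'.
have [ok2 _ _ fr2] := lcu_ok_cons (2 ^ size ls) fok.
have ln : l \notin e :: ls by rewrite inE negb_or le.
have -> : zeros (e :: l :: ls) = o l (proj R false) *m zeros (e :: ls).
  rewrite -zeros_cons //; congr (ctl _ _); apply/ffunP => q; rewrite !ffunE !inE.
  by rewrite orbCA.
rewrite lcu_mx_cons // [size _]/= pauli_averageS; have {IH} := (IH _ ok1, IH _ ok2).
set A := circuit_mx _; set B := circuit_mx (lcu e ls _) => -[AA BB].
set Z := zeros _ in AA BB *.
(* One branch of the label [l]: everything on other qubits moves out of the Hadamard sandwich, which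
   leaves the factor 1/2 for either value [b]. *)
have corner b D : (forall u, D *m o l u = o l u *m D) ->
    o l (proj R false) *m Z *m (o l hadamard *m (o l (proj R b) *m D) *m o l hadamard)
      *m (o l (proj R false) *m Z) = 2^-1 *: (o l (proj R false) *m (Z *m D *m Z)).
  move=> Dc; have Zc u : Z *m o l u = o l u *m Z by apply: zeros_comm.
  rewrite -!mulmxA (mulmxA D) Dc -(mulmxA _ D) (mulmxA D) Dc -(mulmxA _ D) !mulmxA.
  rewrite -!(mulmxA _ Z (o _ _)) !Zc !mulmxA -!(mulmxA _ Z (o _ _)) !Zc !mulmxA.
  rewrite -!(mulmxA _ Z (o _ _)) !Zc !mulmxA -!(mulmxA _ Z (o _ _)) !Zc !mulmxA.
  by rewrite !one_qubitM hadamard_corner one_qubitZ -!scalemxAl.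
rewrite mulmxDr mulmxDl mulmxDr mulmxDl !corner; try by move=> u; apply: circuit_comm.
rewrite AA BB; set SA := pauli_average _ f; set SB := pauli_average _ _.
move: SA SB => SA SB {AA BB}.
by rewrite -scalemxAr mulmxDr scalerDr !mulmxA.
Qed.

(** Gate counts matter besides costs because one more control adds a unit per gate. The summand 2
    absorbs the two Hadamard gates of a level, so that the doubling recursion closes. *)
Lemma lcu_size e ls f : (size (lcu e ls f) + 2 <= 4 * 2 ^ size ls)%N.
Proof.
elim: ls f => [|l ls IH] f //=; rewrite !size_cat !size_map /= expnS.
by have := IH f; have := IH (fun i => f (2 ^ size ls + i)%N); lia.
Qed.

(** A gate at the bottom collects one control per label qubit, whence the factor [(size ls).+1] on
    top of the gate count. *)
Lemma lcu_cost e ls f : (circuit_cost (lcu e ls f) + 2 <= 4 * 2 ^ size ls * (size ls).+1)%N.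
Proof.
elim: ls f => [|l ls IH] f.
  by rewrite /lcu !circuit_cost_cons !plain_cost /circuit_cost big_nil.
rewrite lcu_cons circuit_cost_cons !circuit_cost_cat circuit_cost_cons plain_cost.
rewrite (_ : circuit_cost [::] = 0%N); last by rewrite /circuit_cost big_nil.
set f' := fun i => f _.
have c1 := circuit_cost_add_ctrl l false (lcu e ls f).
have c2 := circuit_cost_add_ctrl l true (lcu e ls f').
move: c1 c2 (IH f) (IH f') (lcu_size e ls f) (lcu_size e ls f').
rewrite [size (_ :: _)]/= expnS.
move: (circuit_cost (map (add_ctrl l false) _)) (circuit_cost (map (add_ctrl l true) _)) => x y.
move: (circuit_cost (lcu e ls f)) (circuit_cost (lcu e ls f')) => x' y'.
move: (size (lcu e ls f)) (size (lcu e ls f')) (2 ^ size ls)%N (size ls) => a b p k.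
nia.
Qed.

(** A sign flip of the value 0 of [e], controlled on zeros in [ls], flips exactly the all-zero state
    of [e :: ls]; a single gate thus realizes the reflection 1 - 2 Pi. *)
Definition zero_reflection e ls : gate R n :=
  Gate (ctrl0 ls) (BUnitary e (mx2 (- 1) 0 0 1)).

Lemma zero_reflection_mx e ls : e \notin ls ->
  gate_mx (zero_reflection e ls) = 1%:M - 2 *: zeros (e :: ls).
Proof.
move=> els; rewrite gate_mxE /= -/(zeros ls) zeros_cons //.
have -> : mx2 (- 1) 0 0 1 = 1%:M - 2 *: proj R false :> 'M[C]_2.
  by apply/matrixP => i j; rewrite !mxE; case: i => [[|[]]] // ?; case: j => [[|[]]] // ? /=; ring.
rewrite -scaleNr one_qubitD one_qubit1 one_qubitZ mulmxDr mulmx1 mulmxDl zeros_id.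
rewrite -scalemxAr -scalemxAl zeros_comm // -mulmxA zeros_id addrC addrA subrK.
by rewrite scaleNr.
Qed.

Lemma zero_reflection_wf e ls : e \notin ls -> gate_wf (zero_reflection e ls).
Proof.
move=> els; split; last by rewrite ffunE (negbTE els).
apply: unitary_mx2; rewrite ?rmorphN /= ?conjC1 ?conjC0; ring.
Qed.

Lemma zero_reflection_free q e ls : q \notin e :: ls -> free_of q (zero_reflection e ls).
Proof.
by rewrite inE negb_or eq_sym => /andP[qe qls]; split=> //; rewrite ffunE (negbTE qls).
Qed.

Lemma zero_reflection_cost e ls : (gate_cost (zero_reflection e ls) <= (size ls).+1)%N.
Proof.
rewrite /gate_cost add1n ltnS (leq_trans _ (card_size ls)) //.
apply/subset_leq_card/fintype.subsetP => q; rewrite !inE ffunE.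
by case: ifP.
Qed.
End CombinationOfPaulis.

(** * Tails of the exponential series *)

Section ExponentialSeries.
Variable R : realType.
Implicit Types (x y T : R).

(** A bound on finite tails, uniform in [N], passes to the limits of scalar and of matrix series
    alike. *)
Definition exp_tail_le (K : nat) x T :=
  forall N, \sum_(K <= k < N) exp_coeff x k <= T.

Lemma exp_sum_le x N : 0 <= x -> \sum_(0 <= k < N) exp_coeff x k <= expR x.
Proof.
move=> x0; apply: (nondecreasing_cvgn_le (u_ := series (exp_coeff x))).
  by apply: nondecreasing_series => n _ _; exact: exp_coeff_ge0.
exact: is_cvg_series_exp_coeff.
Qed.

(* Chernoff's trick: for [k >= K] the factor [e ^ (k - K)] is at least 1. *)
Lemma exp_tail_chernoff (K : nat) x : 0 <= x ->
  exp_tail_le K x (expR (expR 1 * x - K%:R)).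
Proof.
move=> x0 N; have e0 : 0 <= expR 1 * x by rewrite mulr_ge0 // expR_ge0.
have e1 : 1 <= expR 1 :> R by rewrite -expR0 ler_expR.
rewrite expRD mulrC expRN.
apply: (@le_trans _ _ ((expR K%:R)^-1 * \sum_(K <= k < N) exp_coeff (expR 1 * x) k)).
  rewrite mulr_sumr big_nat_cond [leRHS]big_nat_cond; apply: ler_sum => k /andP[/andP[Kk _] _].
  rewrite /exp_coeff /= mulrA ler_wpM2r ?invr_ge0 ?ler0n // exprMn mulrA.
  rewrite -[leLHS]mul1r ler_wpM2r ?exprn_ge0 // ler_pdivlMl ?expR_gt0 // mulr1.
  by rewrite -[K%:R]mulr1 expRM_natl ler_weXn2l.
rewrite ler_wpM2l ?invr_ge0 ?expR_ge0 //.
have [NK|KN] := leqP N K; first by rewrite big_geq ?expR_ge0.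
apply: le_trans (exp_sum_le N e0); rewrite [leRHS](big_cat_nat (n := K)) //= ?(ltnW KN) //.
by rewrite lerDr sumr_ge0 // => k _; exact: exp_coeff_ge0.
Qed.

Lemma exp_tail_ge0 K x T : exp_tail_le K x T -> 0 <= T.
Proof. by move/(_ 0%N); rewrite big_geq. Qed.

Lemma series_tail K (u : R ^nat) x T (l : R) : (forall k, `|u k| <= exp_coeff x k) ->
  exp_tail_le K x T -> (series u @ \oo --> l)%classic ->
  `|l - series u K| <= T.
Proof.
move=> ux xT ul.
have : ((fun N => `|series u N - series u K|) @ \oo --> `|l - series u K|)%classic.
  by apply: cvg_norm; apply: cvgB => //; exact: cvg_cst.
move/cvgr_to_le; apply; near=> N; have KN : (K <= N)%N by near: N; exists K.
rewrite /series /= (big_cat_nat (n := K)) //= addrAC subrr add0r.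
by apply: le_trans (xT N); apply: le_trans (ler_norm_sum _ _ _) _; apply: ler_sum => k _.
Unshelve. all: by end_near.
Qed.

Definition texp (K : nat) (z : R[i]) : R[i] := \sum_(k < K) (k`!%:R)^-1 * z ^+ k.

Lemma ReD (a b : R[i]) : complex.Re (a + b) = complex.Re a + complex.Re b.
Proof. by case: a; case: b. Qed.
Lemma ImD (a b : R[i]) : complex.Im (a + b) = complex.Im a + complex.Im b.
Proof. by case: a; case: b. Qed.

Lemma Re_sum (I : Type) (r : seq I) (P : pred I) (F : I -> R[i]) :
  complex.Re (\sum_(i <- r | P i) F i) = \sum_(i <- r | P i) complex.Re (F i).
Proof. exact: (big_morph _ ReD). Qed.
Lemma Im_sum (I : Type) (r : seq I) (P : pred I) (F : I -> R[i]) :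
  complex.Im (\sum_(i <- r | P i) F i) = \sum_(i <- r | P i) complex.Im (F i).
Proof. exact: (big_morph _ ImD). Qed.

(** The coefficients are put into the shape of [cos_coeff] and [sin_coeff], so that the parts of
    [texp] become cosine and sine partial sums. *)
Lemma imaginary_exp y k : Complex 0 y ^+ k = Complex
  ((~~ odd k)%:R * (-1) ^+ k./2 * y ^+ k) ((odd k)%:R * (-1) ^+ k.-1./2 * y ^+ k).
Proof.
elim: k => [|k IH]; first by rewrite /= !expr0 !mulr1 mulr0n.
rewrite exprS IH.
have mulC (a b c d : R) : Complex a b * Complex c d = Complex (a * c - b * d) (a * d + b * c) by [].
rewrite mulC /= uphalf_half; case: (boolP (odd k)) => k2; rewrite /= ?mulr1n ?mulr0n.
  have -> : k./2 = k.-1./2 by case: k k2 {IH} => //= k /negbTE k2; rewrite uphalf_half k2.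
  by congr Complex; rewrite ?exprS; ring.
by congr Complex; rewrite ?add0n ?exprS; ring.
Qed.

Lemma inv_natC (m : nat) : (m%:R : R[i])^-1 = Complex (m%:R^-1) 0.
Proof. by rewrite -(rmorph_nat (real_complex R)) -fmorphV. Qed.

Lemma Re_texp K y : complex.Re (texp K (Complex 0 y)) = series (cos_coeff y) K.
Proof.
rewrite Re_sum seriesEord /=; apply: eq_bigr => k _.
by rewrite imaginary_exp inv_natC /= mul0r subr0 mulrC.
Qed.

Lemma Im_texp K y : complex.Im (texp K (Complex 0 y)) = series (sin_coeff y) K.
Proof.
rewrite Im_sum seriesEord /=; apply: eq_bigr => k _.
by rewrite imaginary_exp inv_natC /= mul0r addr0 mulrC.
Qed.

(** The point (cos y, sin y) has norm 1 and each coordinate moves by at most [T], so the squared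
    norm is at most 1 + 4 T + 2 T^2. *)
Lemma texp_bound K x y T : `|y| <= x -> exp_tail_le K x T ->
  complex.Re (texp K (Complex 0 y)) ^+ 2 + complex.Im (texp K (Complex 0 y)) ^+ 2
    <= (1 + 2 * T) ^+ 2.
Proof.
move=> yx xT; have T0 := exp_tail_ge0 xT.
have coeff (b : bool) k j : `|b%:R * (-1) ^+ j * y ^+ k / k`!%:R| <= exp_coeff x k.
  rewrite !normrM normrX normrN1 expr1n mulr1 normfV !normr_nat /exp_coeff /=.
  rewrite ler_wpM2r ?invr_ge0 ?ler0n // normrX -[leRHS]mul1r.
  rewrite ler_pM ?ler0n ?exprn_ge0 ?normr_ge0 //; first by case: b; rewrite ?ler01.
  by rewrite lerXn2r ?nnegrE ?normr_ge0 // (le_trans (normr_ge0 y)).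
have hc : `|cos y - series (cos_coeff y) K| <= T.
  apply: (series_tail (x := x)) => // [k|]; first exact: coeff.
  by rewrite unlock; exact: is_cvg_series_cos_coeff.
have hs : `|sin y - series (sin_coeff y) K| <= T.
  apply: (series_tail (x := x)) => // [k|]; first exact: coeff.
  by rewrite unlock; exact: is_cvg_series_sin_coeff.
rewrite Re_texp Im_texp; move: hc hs (cos2Dsin2 y).
set c := cos y; set s := sin y; set c' := series _ K; set s' := series _ K.
rewrite !ler_norml => /andP[c1 c2] /andP[s1 s2] cs.
have [cl su] : -1 <= c <= 1 /\ -1 <= s <= 1.
  by rewrite cos_le1 cos_geN1 sin_le1 sin_geN1.
have p1 : (c - c') ^+ 2 <= T ^+ 2 by nra.
have p2 : (s - s') ^+ 2 <= T ^+ 2 by nra.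
have p3 : - (c * (c - c')) <= T by nra.
have p4 : - (s * (s - s')) <= T by nra.
nra.
Qed.
End ExponentialSeries.

(** * Operator norm and matrix exponential *)

Section OperatorNorm.
Variable R : realType.
Local Notation C := (R[i]).
Local Notation Re := (@complex.Re R).
Local Notation Im := (@complex.Im R).

(** Real-valued form of [vnorm2], so that order arguments and limits take place in [R]. *)
Definition sqnorm d (v : 'cV[C]_d) : R := \sum_i (Re (v i 0) ^+ 2 + Im (v i 0) ^+ 2).

Section Dim.
Variable d : nat.
Implicit Types (A B M : 'M[C]_d) (u v : 'cV[C]_d) (a b : R).

Lemma vnorm2E v : vnorm2 v = (sqnorm v)%:C%C.
Proof. by rewrite rmorph_sum; apply: eq_bigr => i _; rewrite -add_Re2_Im2. Qed.

Lemma opnorm_leP A a : opnorm_le A a <-> forall v, sqnorm (A *m v) <= a ^+ 2 * sqnorm v.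
Proof.
by split=> h v; have := h v; rewrite !vnorm2E -(rmorphM (real_complex R)) /= lecR.
Qed.

Lemma sqnorm_ge0 v : 0 <= sqnorm v.
Proof. by apply: sumr_ge0 => i _; rewrite addr_ge0 ?sqr_ge0. Qed.

Lemma sqnorm_eq0 v : sqnorm v = 0 -> v = 0.
Proof.
move=> /eqP; rewrite psumr_eq0; last by move=> i _; rewrite addr_ge0 ?sqr_ge0.
move=> /allP h; apply/colP => i; have := h i (mem_index_enum _).
rewrite paddr_eq0 ?sqr_ge0 // !sqrf_eq0 mxE.
by case: (v i 0) => x y /= /andP[/eqP -> /eqP ->].
Qed.

Lemma sqnormZ (c : C) v : sqnorm (c *: v) = (Re c ^+ 2 + Im c ^+ 2) * sqnorm v.
Proof.
rewrite mulr_sumr; apply: eq_bigr => i _; rewrite mxE.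
by case: c => x y; case: (v i 0) => z t /=; ring.
Qed.

(** Young's inequality in each coordinate. Choosing [a] and [b] as the two norm bounds turns the
    right side into (a + b)^2, which is the triangle inequality. *)
Lemma sqnormD_le u v a b : 0 < a -> 0 < b ->
  sqnorm (u + v) <= (1 + b / a) * sqnorm u + (1 + a / b) * sqnorm v.
Proof.
move=> a0 b0; rewrite !mulr_sumr -big_split; apply: ler_sum => i _; rewrite mxE.
case: (u i 0) => x y; case: (v i 0) => z t /=.
have young p q : (p + q) ^+ 2 <= (1 + b / a) * p ^+ 2 + (1 + a / b) * q ^+ 2.
  rewrite -subr_ge0.
  have -> : (1 + b / a) * p ^+ 2 + (1 + a / b) * q ^+ 2 - (p + q) ^+ 2 =
    (b * p - a * q) ^+ 2 / (a * b) by field; rewrite !gt_eqF.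
  by rewrite divr_ge0 ?sqr_ge0 // mulr_ge0 // ltW.
by have := young x z; have := young y t; lra.
Qed.

Lemma opnorm_leD A B a b : 0 <= a -> 0 <= b ->
  opnorm_le A a -> opnorm_le B b -> opnorm_le (A + B) (a + b).
Proof.
move=> a0 b0 /opnorm_leP hA /opnorm_leP hB; apply/opnorm_leP => v; rewrite mulmxDl.
(* The weights [b / a] and [a / b] require nonzero bounds; a zero bound forces the corresponding
   vector to vanish. *)
have null (M : 'M[C]_d) : sqnorm (M *m v) <= 0 ^+ 2 * sqnorm v -> M *m v = 0.
  rewrite expr0n mul0r => h; apply: sqnorm_eq0.
  by apply/eqP; rewrite eq_le h sqnorm_ge0.
have [az|an] := eqVneq a 0; first by rewrite null ?add0r -?az // az add0r; exact: hB.
have [bz|bn] := eqVneq b 0; first by rewrite [B *m v]null ?addr0 -?bz // bz addr0; exact: hA.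
have ap : 0 < a by rewrite lt_def an.
have bp : 0 < b by rewrite lt_def bn.
apply: le_trans (sqnormD_le _ _ ap bp) _.
apply: (@le_trans _ _ ((1 + b / a) * (a ^+ 2 * sqnorm v) + (1 + a / b) * (b ^+ 2 * sqnorm v))).
  by apply: lerD; rewrite ler_wpM2l // addr_ge0 // divr_ge0.
by rewrite le_eqVlt; apply/orP; left; apply/eqP; field; rewrite an bn.
Qed.

Lemma opnorm_le0 a : opnorm_le (0 : 'M[C]_d) a.
Proof.
apply/opnorm_leP => v; rewrite mul0mx -(scale0r 0) sqnormZ /= expr0n addr0 mul0r.
by rewrite mulr_ge0 ?sqr_ge0 ?sqnorm_ge0.
Qed.

Lemma opnorm_le1 : opnorm_le (1%:M : 'M[C]_d) 1.
Proof. by apply/opnorm_leP => v; rewrite mul1mx expr1n mul1r. Qed.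

Lemma opnorm_leZ (c : C) A (r a : R) : Re c ^+ 2 + Im c ^+ 2 <= r ^+ 2 ->
  opnorm_le A a -> opnorm_le (c *: A) (r * a).
Proof.
move=> cr /opnorm_leP hA; apply/opnorm_leP => v; rewrite -scalemxAl sqnormZ exprMn -mulrA.
by rewrite ler_pM ?sqnorm_ge0 // addr_ge0 ?sqr_ge0.
Qed.

Lemma opnorm_leM A B a b : opnorm_le A a -> opnorm_le B b -> opnorm_le (A *m B) (a * b).
Proof.
move=> /opnorm_leP hA /opnorm_leP hB; apply/opnorm_leP => v; rewrite -mulmxA.
apply: le_trans (hA _) _; rewrite exprMn -[leRHS]mulrA; exact: (ler_wpM2l (sqr_ge0 a) (hB v)).
Qed.

Lemma opnorm_leX A a k : opnorm_le A a -> opnorm_le (A ^+ k) (a ^+ k).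
Proof.
move=> hA; elim: k => [|k IH]; first by rewrite !expr0; exact: opnorm_le1.
by rewrite !exprS; exact: opnorm_leM.
Qed.

Lemma opnorm_le_sum (I : Type) (r : seq I) (P : pred I) (F : I -> 'M[C]_d) (f : I -> R) :
  (forall i, P i -> 0 <= f i) -> (forall i, P i -> opnorm_le (F i) (f i)) ->
  opnorm_le (\sum_(i <- r | P i) F i) (\sum_(i <- r | P i) f i).
Proof.
move=> f0 hF; suff [] : 0 <= \sum_(i <- r | P i) f i /\
  opnorm_le (\sum_(i <- r | P i) F i) (\sum_(i <- r | P i) f i) by [].
apply: (big_rec2 (fun x (y : 'M[C]_d) => 0 <= x /\ opnorm_le y x)).
  by split => //; exact: opnorm_le0.
move=> i y x Pi [x0 hy]; split; first by rewrite addr_ge0 ?f0.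
by apply: opnorm_leD => //; [exact: f0 | exact: hF].
Qed.

Lemma opnorm_le_trans A a b : 0 <= a -> a <= b -> opnorm_le A a -> opnorm_le A b.
Proof.
move=> a0 ab /opnorm_leP hA; apply/opnorm_leP => v; apply: le_trans (hA v) _.
by rewrite ler_wpM2r ?sqnorm_ge0 // lerXn2r // nnegrE (le_trans a0).
Qed.

Lemma opnorm_le_unitary A : (map_mx Num.conj A)^T *m A = 1%:M -> opnorm_le A 1.
Proof.
move=> uA v; rewrite expr1n mul1r.
have vE (u : 'cV[C]_d) : (vnorm2 u)%:M = (map_mx Num.conj u)^T *m u :> 'M[C]_1.
  apply/matrixP => i j; rewrite !ord1 !mxE mulr1n; apply: eq_bigr => k _.
  by rewrite !mxE normCK mulrC.
suff -> : vnorm2 (A *m v) = vnorm2 v by [].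
have : (vnorm2 (A *m v))%:M = (vnorm2 v)%:M :> 'M[C]_1.
  by rewrite !vE map_mxM trmx_mul mulmxA -(mulmxA (_^T)) uA mulmx1.
by move/matrixP/(_ 0 0); rewrite !mxE !mulr1n.
Qed.

Lemma opnorm_le_entry A a (i j : 'I_d) : opnorm_le A a ->
  Re (A i j) ^+ 2 + Im (A i j) ^+ 2 <= a ^+ 2.
Proof.
move=> /opnorm_leP /(_ (delta_mx j 0)) h.
have -> : a ^+ 2 = a ^+ 2 * sqnorm (delta_mx j 0 : 'cV[C]_d).
  rewrite /sqnorm (bigD1 j) //= big1 => [|k kj]; rewrite !mxE !eqxx ?(negbTE kj) /=.
    by rewrite expr1n expr0n !addr0 mulr1.
  by rewrite expr0n addr0.
apply: le_trans h; rewrite -colE /sqnorm (bigD1 i) //= mxE lerDl.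
by apply: sumr_ge0 => k _; rewrite addr_ge0 ?sqr_ge0.
Qed.
End Dim.

Lemma opnorm_le_pauli n (P : pstring n) : opnorm_le (pauli_mx R P) 1.
Proof.
apply: opnorm_le_unitary; suff -> : (map_mx Num.conj (pauli_mx R P))^T = pauli_mx R P.
  exact: pauli_sqr.
apply/matrixP => x y; rewrite !mxE rmorph_prod; apply: eq_bigr => q _ /=.
rewrite /sigma; case: (P q) => [[|[|[|[|]]]]] // ?; rewrite /= !mxE.
all: by case: (bit q x); case: (bit q y) => //=; rewrite ?conjC0 ?conjC1 ?rmorphN ?conjC1 //;
  apply/eqP; rewrite eq_complex /= ?opprK ?oppr0 ?eqxx.
Qed.

(** * Convergence and truncation of the matrix exponential *)

Section MatrixExponential.
Variable d : nat.
Implicit Types (M : 'M[C]_d).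

Definition expsum (K : nat) M : 'M[C]_d := \sum_(k < K) (k`!%:R)^-1 *: M ^+ k.

Lemma cvg_fin_sum (I : Type) (r : seq I) (u : I -> nat -> R) (l : I -> R) :
  (forall i, (u i @ \oo --> l i)%classic) ->
  ((fun N => \sum_(i <- r) u i N) @ \oo --> \sum_(i <- r) l i)%classic.
Proof.
move=> h; elim: r => [|i r IH].
  rewrite big_nil (_ : (fun N => _) = (fun=> 0)); first exact: cvg_cst.
  by apply/funext => N; rewrite big_nil.
rewrite big_cons (_ : (fun N => _) = (fun N => u i N + \sum_(i <- r) u i N)).
  by apply: cvgD.
by apply/funext => N; rewrite big_cons.
Qed.

(** Convergence is split into real and imaginary parts because [mexp] takes its limits in this
    way. *)
Definition ccvg (u : nat -> C) (l : C) : Prop :=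
  ((fun N => Re (u N)) @ \oo --> Re l)%classic /\ ((fun N => Im (u N)) @ \oo --> Im l)%classic.

Lemma ccvgB u l c : ccvg u l -> ccvg (fun N => u N - c) (l - c).
Proof.
move=> [h1 h2]; split.
  rewrite (_ : (fun N => _) = (fun N => Re (u N) + Re (- c))); last first.
    by apply/funext => N; rewrite ReD.
  by rewrite ReD; apply: cvgD => //; exact: cvg_cst.
rewrite (_ : (fun N => _) = (fun N => Im (u N) + Im (- c))); last first.
  by apply/funext => N; rewrite ImD.
by rewrite ImD; apply: cvgD => //; exact: cvg_cst.
Qed.

Lemma ccvgMr u l c : ccvg u l -> ccvg (fun N => u N * c) (l * c).
Proof.
move=> [h1 h2]; case: l h1 h2 => lr li h1 h2; case: c => cr ci; split => /=.
  rewrite (_ : (fun N => _) = (fun N => Re (u N) * cr - Im (u N) * ci)); last first.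
    by apply/funext => N; case: (u N).
  by apply: cvgB; apply: cvgMl.
rewrite (_ : (fun N => _) = (fun N => Re (u N) * ci + Im (u N) * cr)); last first.
  by apply/funext => N; case: (u N).
by apply: cvgD; apply: cvgMl.
Qed.

Lemma ccvg_sum (I : Type) (r : seq I) (u : I -> nat -> C) (l : I -> C) :
  (forall i, ccvg (u i) (l i)) -> ccvg (fun N => \sum_(i <- r) u i N) (\sum_(i <- r) l i).
Proof.
move=> h; split.
  rewrite Re_sum (_ : (fun N => _) = (fun N => \sum_(i <- r) Re (u i N))); last first.
    by apply/funext => N; rewrite Re_sum.
  by apply: cvg_fin_sum => i; have [] := h i.
rewrite Im_sum (_ : (fun N => _) = (fun N => \sum_(i <- r) Im (u i N))); last first.
  by apply/funext => N; rewrite Im_sum.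
by apply: cvg_fin_sum => i; have [] := h i.
Qed.

Lemma expsum_term M x k : 0 <= x -> opnorm_le M x ->
  opnorm_le ((k`!%:R)^-1 *: M ^+ k) (exp_coeff x k).
Proof.
move=> x0 hM; rewrite /exp_coeff /= mulrC; apply: opnorm_leZ; last exact: opnorm_leX.
by rewrite inv_natC /= expr0n addr0.
Qed.

(** The value given by [limn] is meaningful only once convergence is known. Here the entries of the
    terms are dominated by the scalar exponential series at [x]. *)
Lemma mexp_ccvg M x (i j : 'I_d) : 0 <= x -> opnorm_le M x ->
  ccvg (fun N => expsum N M i j) (mexp M i j).
Proof.
move=> x0 hM; pose a k := ((k`!%:R)^-1 *: M ^+ k) i j.
have sqr_le (p q r : R) : 0 <= r -> p ^+ 2 + q ^+ 2 <= r ^+ 2 -> `|p| <= r.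
  move=> r0 h; rewrite -(ler_pXn2r (n := 2)) ?nnegrE ?normr_ge0 // real_normK ?num_real //.
  by apply: le_trans h; rewrite lerDl sqr_ge0.
have entry k : Re (a k) ^+ 2 + Im (a k) ^+ 2 <= exp_coeff x k ^+ 2.
  by apply: opnorm_le_entry; exact: expsum_term.
have cvg_a (f : C -> R) : (forall k, `|f (a k)| <= exp_coeff x k) ->
    cvgn (series (fun k => f (a k))).
  move=> h; apply: normed_cvg.
  apply: series_le_cvg (is_cvg_series_exp_coeff x) => k; last exact: h.
    exact: normr_ge0.
  exact: exp_coeff_ge0.
rewrite /ccvg /mexp !mxE /=; split.
  rewrite (_ : (fun N => _) = series (fun k => Re (a k))).
    by apply: cvg_a => k; apply: sqr_le (entry k); exact: exp_coeff_ge0.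
  by apply/funext => N; rewrite summxE Re_sum seriesEord.
rewrite (_ : (fun N => _) = series (fun k => Im (a k))).
  by apply: cvg_a => k; apply: (@sqr_le _ (Re (a k))); rewrite ?exp_coeff_ge0 // addrC.
by apply/funext => N; rewrite summxE Im_sum seriesEord.
Qed.

(** For a fixed vector each finite tail is bounded by [T], and the squared norm is continuous along
    the entrywise limit. *)
Lemma expsum_mexp K M x T : 0 <= x -> opnorm_le M x -> exp_tail_le K x T ->
  opnorm_le (expsum K M - mexp M) T.
Proof.
move=> x0 hM xT; apply/opnorm_leP => v.
have -> : sqnorm ((expsum K M - mexp M) *m v) = sqnorm ((mexp M - expsum K M) *m v).
  by rewrite -opprB mulNmx -scaleN1r sqnormZ /= oppr0 expr0n addr0 sqrrN expr1n mul1r.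
have cvg_w i : ccvg (fun N => ((expsum N M - expsum K M) *m v) i 0)
    (((mexp M - expsum K M) *m v) i 0).
  rewrite mxE (_ : (fun N => _) =
    (fun N => \sum_j (expsum N M i j - expsum K M i j) * v j 0)); last first.
    by apply/funext => N; rewrite mxE; apply: eq_bigr => j _; rewrite !mxE.
  apply: ccvg_sum => j; apply: ccvgMr.
  have -> : (mexp M - expsum K M) i j = mexp M i j - expsum K M i j.
    by rewrite mxE; congr (_ + _); rewrite mxE.
  by apply: ccvgB; exact: mexp_ccvg hM.
have : ((fun N => sqnorm ((expsum N M - expsum K M) *m v)) @ \oo -->
    sqnorm ((mexp M - expsum K M) *m v))%classic.
  apply: cvg_fin_sum => i; have [h1 h2] := cvg_w i.
  exact: (cvgD (cvgM h1 h1) (cvgM h2 h2)).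
move/cvgr_to_le; apply; near=> N; have KN : (K <= N)%N by near: N; exists K.
have -> : expsum N M - expsum K M = \sum_(K <= k < N) (k`!%:R)^-1 *: M ^+ k.
  rewrite /expsum -!(big_mkord predT (fun k => (k`!%:R)^-1 *: M ^+ k)).
  by rewrite (big_cat_nat (n := K)) //= addrAC subrr add0r.
suff /opnorm_leP : opnorm_le (\sum_(K <= k < N) (k`!%:R)^-1 *: M ^+ k) T by apply.
apply: (@opnorm_le_trans _ _ (\sum_(K <= k < N) exp_coeff x k)) => //.
  by apply: sumr_ge0 => k _; exact: exp_coeff_ge0.
apply: opnorm_le_sum => k _; first exact: exp_coeff_ge0.
exact: expsum_term.
Unshelve. all: by end_near.
Qed.
End MatrixExponential.
End OperatorNorm.

(** * The qubitized walk *)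

Section PolynomialOfMatrix.
Variables (F : comNzRingType) (d : nat).
Implicit Types (W M : 'M[F]_d) (p q : {poly F}).

(* Unlike [horner_mx], this does not require the dimension to be a successor. *)
Definition peval W p : 'M[F]_d := \sum_(i < size p) p`_i *: W ^+ i.

End PolynomialOfMatrix.

Lemma peval_horner (F : comNzRingType) d (W : 'M[F]_d.+1) p : peval W p = horner_mx W p.
Proof.
rewrite -[p in RHS]coefK poly_def linear_sum /=; apply: eq_bigr => i _.
by rewrite linearZ /= rmorphXn /= horner_mx_X.
Qed.

Lemma matrix0P (F : nzRingType) (A B : 'M[F]_0) : A = B.
Proof. by apply/matrixP => -[]. Qed.

Section PolynomialOfMatrixTheory.
Variables (F : comNzRingType) (d : nat).
Implicit Types (W M : 'M[F]_d) (p q : {poly F}).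

Lemma pevalD W p q : peval W (p + q) = peval W p + peval W q.
Proof.
by case: d W => [|d'] W; [exact: matrix0P | rewrite !peval_horner rmorphD].
Qed.

Lemma pevalZ W a p : peval W (a *: p) = a *: peval W p.
Proof.
by case: d W => [|d'] W; [exact: matrix0P | rewrite !peval_horner linearZ].
Qed.

Lemma pevalM W p q : peval W (p * q) = peval W p *m peval W q.
Proof.
by case: d W => [|d'] W; [exact: matrix0P | rewrite !peval_horner rmorphM].
Qed.

Lemma pevalX W : peval W 'X = W.
Proof.
by case: d W => [|d'] W; [exact: matrix0P | rewrite !peval_horner horner_mx_X].
Qed.

Lemma peval1 W : peval W 1 = 1%:M.
Proof.
by case: d W => [|d'] W; [exact: matrix0P | rewrite !peval_horner rmorph1].
Qed.

Lemma pevalC W c : peval W c%:P = c *: 1%:M.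
Proof. by rewrite -alg_polyC pevalZ peval1. Qed.

Lemma pevalXn W p k : peval W (p ^+ k) = peval W p ^+ k.
Proof.
by elim: k => [|k IH]; rewrite ?expr0 ?peval1 // !exprS pevalM IH.
Qed.

Lemma peval_sum W (I : Type) (r : seq I) (f : I -> {poly F}) :
  peval W (\sum_(i <- r) f i) = \sum_(i <- r) peval W (f i).
Proof.
apply: (big_morph _ (pevalD W)).
by rewrite -[0 in LHS](scale0r (1 : {poly F})) pevalZ scale0r.
Qed.

Lemma peval_comm W M p : W *m M = M *m W -> peval W p *m M = M *m peval W p.
Proof.
move=> WM; rewrite /peval mulmx_suml mulmx_sumr; apply: eq_bigr => i _.
rewrite -scalemxAl -scalemxAr; congr (_ *: _).
elim: (i : nat) => [|j IH]; first by rewrite !expr0 mulmx1 mul1mx.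
by rewrite exprS -[_ *m M]mulmxA IH mulmxA WM -mulmxA.
Qed.

Lemma expmxZ c M k : (c *: M) ^+ k = c ^+ k *: M ^+ k.
Proof.
elim: k => [|k IH]; first by rewrite !expr0 scale1r.
rewrite !exprS IH; change ((c *: M) *m (c ^+ k *: M ^+ k) = (c * c ^+ k) *: (M *m M ^+ k)).
by rewrite -scalemxAl -scalemxAr scalerA.
Qed.

End PolynomialOfMatrixTheory.

(** This intertwining carries the corner identity of the averaged walk to its powers, hence to the
    truncated series. *)
Lemma expmx_mull (F : comNzRingType) d d' (M : 'M[F]_d) (A : 'M[F]_(d, d')) k (S : 'M[F]_d') :
  M *m A = A *m S -> M ^+ k *m A = A *m S ^+ k.
Proof.
move=> MA; elim: k => [|k IH]; first by rewrite !expr0 mulmx1 mul1mx.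
by rewrite !exprSr -[LHS]mulmxA MA mulmxA IH -mulmxA.
Qed.

Section WalkCircuit.
Variables (R : realType) (n : nat).
Local Notation C := (R[i]).
Local Notation o := (@one_qubit_mx R n).

(** * Signal processing of a walk as a circuit *)

Section SignalProcessingCircuit.
Variables (q : 'I_n) (c : circuit R n).
Hypotheses (wfc : List.Forall (@gate_wf R n) c) (freec : List.Forall (free_of q) c).

Fixpoint qsp_circuit (R0 : 'M[C]_2) (Rs : seq 'M[C]_2) : circuit R n :=
  if Rs is r :: Rs' then
    qsp_circuit R0 Rs' ++ map (add_ctrl q false) c ++ [:: plain (BUnitary q r)]
  else [:: plain (BUnitary q R0)].

Lemma qsp_circuit_wf R0 Rs : unitary R0 -> List.Forall (@unitary _ 2) Rs ->
  List.Forall (@gate_wf R n) (qsp_circuit R0 Rs).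
Proof.
have wf1 u : unitary u -> gate_wf (plain (BUnitary q u)) by split; rewrite ?ffunE.
move=> uR0; elim=> [|r Rs' ur _ IH] /=; first by constructor => //; exact: wf1.
apply: ForallP_cat => //; apply: ForallP_cat; first exact: wf_add_ctrl.
by constructor => //; exact: wf1.
Qed.

Lemma qsp_circuit_cost R0 Rs : (circuit_cost (qsp_circuit R0 Rs) <=
  1 + size Rs * (circuit_cost c + size c + 1))%N.
Proof.
elim: Rs => [|r Rs IH]; first by rewrite /circuit_cost big_seq1 plain_cost.
rewrite [qsp_circuit _ _]/= !circuit_cost_cat [size _]/=.
rewrite [circuit_cost [:: _]]big_seq1 plain_cost.
by have := circuit_cost_add_ctrl q false c; move: IH; rewrite mulSn; lia.
Qed.

Local Notation W := (circuit_mx c).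

(** [W] commutes with every operator on the signal qubit, so it can stand in for the scalar variable
    of [qsp]. The matrices [mx2 1 0 0 0] and [mx2 0 0 1 0] are |0><0| and |1><0|. *)
Lemma qsp_circuit_mx R0 Rs :
  circuit_mx (qsp_circuit R0 Rs) *m o q (proj R false) =
  peval W (qsp R0 Rs).1 *m o q (mx2 1 0 0 0) + peval W (qsp R0 Rs).2 *m o q (mx2 0 0 1 0).
Proof.
have Wc u : W *m o q u = o q u *m W by apply: circuit_comm.
elim: Rs => [|r Rs IH].
  rewrite [qsp_circuit _ _]/= circuit_mx_cons circuit_mx_nil mul1mx plain_mx /=.
  rewrite one_qubitM !pevalC -!scalemxAl !mul1mx -!one_qubitZ -one_qubitD; congr (o q _).
  apply/matrixP => i j; rewrite !mxE big_ord_recl big_ord1 !mxE.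
  by case: i => [[|[]]] // ?; case: j => [[|[]]] // ?;
    rewrite /= ?(mulr0, mulr1, addr0, add0r) //; congr (R0 _ _); apply: val_inj.
rewrite [qsp_circuit _ _]/= !circuit_mx_cat circuit_mx_cons circuit_mx_nil mul1mx plain_mx.
rewrite -!mulmxA IH circuit_add_ctrl // mulmxDl.
set PQ := qsp R0 Rs; rewrite [qsp R0 (r :: Rs)]/= -/PQ.
set P := peval W PQ.1; set Q := peval W PQ.2.
have Pc u : P *m o q u = o q u *m P by apply: peval_comm.
have Qc u : Q *m o q u = o q u *m Q by apply: peval_comm.
have oz : o q 0 = 0 by rewrite -(scale0r 0) one_qubitZ scale0r.
have -> : o q (proj R false) *m W *m (P *m o q (mx2 1 0 0 0) + Q *m o q (mx2 0 0 1 0)) =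
    W *m P *m o q (mx2 1 0 0 0).
  rewrite -Wc -mulmxA mulmxDr !Pc !Qc !(mulmxA (o q (proj R false))) !one_qubitM.
  rewrite mx2_proj0 !mx2M !(mulr0, mulr1, addr0, add0r).
  have -> : mx2 0 0 0 0 = 0 :> 'M[C]_2 by apply/matrixP => i j; rewrite !mxE !if_same.
  by rewrite oz mul0mx addr0 -Pc mulmxA.
have -> : o q (proj R (~~ false)) *m (P *m o q (mx2 1 0 0 0) + Q *m o q (mx2 0 0 1 0)) =
    Q *m o q (mx2 0 0 1 0).
  rewrite mulmxDr !Pc !Qc !(mulmxA (o q _)) !one_qubitM.
  rewrite mx2_proj1 !mx2M !(mulr0, mulr1, mul0r, mul1r, addr0, add0r).
  have -> : mx2 0 0 0 0 = 0 :> 'M[C]_2 by apply/matrixP => i j; rewrite !mxE !if_same.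
  by rewrite oz mul0mx add0r.
rewrite !pevalD !pevalZ !pevalM pevalX -/P -/Q.
rewrite mulmxDr !mulmxA -(mulmxA (o q r)).
have WPc u : (W *m P) *m o q u = o q u *m (W *m P) by rewrite -mulmxA Pc !mulmxA Wc.
rewrite -WPc -Qc -!mulmxA !one_qubitM.
(* Used for [a = 0] and [a = 1], where the right factor moves column [a] of [u] into the first
   column. *)
have colE (u : 'M[C]_2) a : u *m (mx2 (1 - a) 0 a 0) =
   (u 0 0 * (1 - a) + u 0 1 * a) *: mx2 1 0 0 0 + (u 1 0 * (1 - a) + u 1 1 * a) *: mx2 0 0 1 0.
  apply/matrixP => i j; rewrite !mxE big_ord_recl big_ord1 !mxE.
  by case: i => [[|[]]] // ?; case: j => [[|[]]] // ?;
    rewrite /= ?(mulr0, mulr1, addr0, add0r) //; congr (u _ _ * _ + u _ _ * _); apply: val_inj.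
have c0 := colE r 0; have c1 := colE r 1.
rewrite subr0 !mulr1 !mulr0 !addr0 in c0; rewrite subrr !mulr1 !mulr0 !add0r in c1.
rewrite c0 c1 !one_qubitD !one_qubitZ !mulmxDr !mulmxDl -!scalemxAr -!scalemxAl.
by rewrite !mulmxA addrACA.
Qed.
End SignalProcessingCircuit.

(** * The walk, its inverse and their average *)

Section Walk.
Variables (e q : 'I_n) (ls : seq 'I_n) (f : nat -> pstring n * R).
Hypotheses (fok : lcu_ok e ls f) (qe : q \notin e :: ls) (fq : forall i, (f i).1 q = 0).

Definition walk : circuit R n := lcu e ls f ++ [:: zero_reflection R e ls].
(** The [lcu] circuit and the reflection are involutions, so reversing their order inverts the
    walk. *)
Definition walk_inv : circuit R n := zero_reflection R e ls :: lcu e ls f.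

Let els : e \notin ls. Proof. by have [/andP[]] := fok. Qed.

Local Notation W := (circuit_mx walk).
Local Notation Wi := (circuit_mx walk_inv).
Local Notation U := (circuit_mx (lcu e ls f)).
Local Notation Pi := (zeros R (e :: ls)).
Local Notation S := (pauli_average (size ls) f).

Lemma walk_wf : List.Forall (@gate_wf R n) walk /\ List.Forall (@gate_wf R n) walk_inv.
Proof.
split; last by constructor; [exact: zero_reflection_wf | exact: lcu_wf].
apply: ForallP_cat; first exact: lcu_wf.
by constructor => //; exact: zero_reflection_wf.
Qed.

Lemma walk_free : List.Forall (free_of q) walk /\ List.Forall (free_of q) walk_inv.
Proof.
have fl : List.Forall (free_of q) (lcu e ls f) by apply: lcu_free.
split; last by constructor => //; exact: zero_reflection_free.
by apply: ForallP_cat => //; constructor => //; exact: zero_reflection_free.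
Qed.

Lemma walk_mx : W = (1%:M - 2 *: Pi) *m U.
Proof.
by rewrite circuit_mx_cat circuit_mx_cons circuit_mx_nil mul1mx zero_reflection_mx.
Qed.

Lemma walk_inv_mx : Wi = U *m (1%:M - 2 *: Pi).
Proof. by rewrite circuit_mx_cons zero_reflection_mx. Qed.

Let reflK : (1%:M - 2 *: Pi) *m (1%:M - 2 *: Pi) = 1%:M.
Proof.
rewrite mulmxBl !mulmxBr !mul1mx mulmx1 -scalemxAl -scalemxAr zeros_id scalerA.
by apply/matrixP => i j; rewrite !mxE; ring.
Qed.

Lemma walkK : W *m Wi = 1%:M.
Proof.
by rewrite walk_mx walk_inv_mx mulmxA -(mulmxA _ U U) lcu_sqr // mulmx1 reflK.
Qed.

Lemma walk_invK : Wi *m W = 1%:M.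
Proof.
by rewrite walk_mx walk_inv_mx mulmxA -(mulmxA U) reflK mulmx1 lcu_sqr.
Qed.

(* The block [Pi U Pi] survives in [W + W^-1] while the off-diagonal blocks cancel. *)
Lemma walk_cos_zeros : (2^-1 *: (W + Wi)) *m Pi = Pi *m (- S).
Proof.
have -> : 2^-1 *: (W + Wi) = U - Pi *m U - U *m Pi.
  rewrite walk_mx walk_inv_mx mulmxBl mulmxBr mul1mx mulmx1 -scalemxAl -scalemxAr.
  by apply/matrixP => i j; rewrite !mxE; field.
rewrite !mulmxBl -(mulmxA U) zeros_id lcu_corner // mulmxN addrAC subrr add0r.
by [].
Qed.

End Walk.

Lemma walk_cost e ls f : (circuit_cost (walk e ls f) <= 5 * 2 ^ size ls * (size ls).+1)%N /\
  (circuit_cost (walk_inv e ls f) <= 5 * 2 ^ size ls * (size ls).+1)%N.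
Proof.
have h1 := lcu_cost e ls f; have h2 := zero_reflection_cost R e ls.
have h3 : (0 < 2 ^ size ls)%N by rewrite expn_gt0.
suff h : (circuit_cost (lcu e ls f) + gate_cost (zero_reflection R e ls) <=
    5 * 2 ^ size ls * (size ls).+1)%N.
  split; last by rewrite circuit_cost_cons addnC.
  by rewrite circuit_cost_cat [circuit_cost [:: _]]big_seq1.
nia.
Qed.

Lemma walk_size e ls f : (size (walk e ls f) <= 4 * 2 ^ size ls)%N.
Proof. by rewrite size_cat /=; have := lcu_size e ls f; lia. Qed.
End WalkCircuit.

(** * The truncated exponential as a signal polynomial *)

Section TruncatedExponential.
Variable R : realType.
Local Notation C := (R[i]).

(** Since (w + 1/w)^k w^K = (w^2 + 1)^k w^(K - k), this is w^K / alpha times the series of degree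
    [K] at c (w + 1/w) / 2, free of negative powers. *)
Definition exp_poly (c alpha : C) (K : nat) : {poly C} :=
  alpha^-1 *: \sum_(k < K.+1) ((k`!%:R)^-1 * (c / 2) ^+ k) *: (('X^2 + 1) ^+ k * 'X^(K - k)).

Lemma horner_exp_poly c alpha K (w : C) : w != 0 ->
  (exp_poly c alpha K).[w] = alpha^-1 * w ^+ K * texp K.+1 (c * (w + w^-1) / 2).
Proof.
move=> w0; rewrite hornerZ -mulrA; congr (_ * _).
rewrite horner_sum mulr_sumr; apply: eq_bigr => -[k /= kK] _.
rewrite !hornerE /=.
have -> : w ^+ K = w ^+ (K - k) * w ^+ k by rewrite -exprD subnK.
have -> : w ^+ 2 + 1 = w * (w + w^-1) by field.
have -> : c * (w + w^-1) / 2 = c / 2 * (w + w^-1) by field.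
by rewrite !exprMn /=; ring.
Qed.

Lemma size_exp_poly c alpha K : (size (exp_poly c alpha K) <= K.*2.+1)%N.
Proof.
apply: leq_trans (size_scale_leq _ _) _; apply: leq_trans (size_sum _ _ _) _.
apply/bigmax_leqP => -[k /= kK] _; apply: leq_trans (size_scale_leq _ _) _.
have s1 : (size ('X^2 + 1 : {poly C})%R <= 3)%N.
  by rewrite (leq_trans (size_polyD _ _)) // size_polyXn size_poly1.
have sk : (size (('X^2 + 1 : {poly C}) ^+ k)%R <= k.*2.+1)%N.
  apply: leq_trans (size_poly_exp_leq _ _) _; rewrite ltnS -muln2 mulnC leq_mul2l.
  by apply/orP; right; case: (size _) s1 => [|[|[|[|]]]].
apply: leq_trans (size_polyMleq _ _) _; rewrite size_polyXn.
by move: sk; move: (size _) => s; lia.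
Qed.

Lemma conjC_Complex (x y : R) : (Complex x y)^* = Complex x (- y). Proof. by []. Qed.

(** [N] is 1 - |P|^2 shifted to an ordinary polynomial. It is positive on the circle because [alpha]
    exceeds the bound of [texp_bound], and its Fejer-Riesz factor is the complement. *)
Lemma exp_poly_complement (tau alpha T : R) K : 0 <= tau -> 1 + 2 * T < alpha ->
  exp_tail_le K.+1 tau T ->
  let P := exp_poly (Complex 0 tau) alpha%:C%C K in
  exists Q : {poly C}, (size Q <= K.*2.+1)%N /\
    forall w, w != 0 -> P.[w] * (P.[cinv w])^* + Q.[w] * (Q.[cinv w])^* = 1.
Proof.
move=> tau0 Talpha xT P; have T0 := exp_tail_ge0 xT.
have sP : (size P <= K.*2.+1)%N := size_exp_poly _ _ _.
pose N := 'X^(K.*2) - P * star K.*2 P.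
have NE w : w != 0 -> N.[w] = w ^+ K.*2 * (1 - P.[w] * (P.[cinv w])^*).
  by move=> w0; rewrite hornerD hornerN hornerM hornerXn star_horner //=; ring.
have sN : (size N <= K.*2.*2.+1)%N.
  apply: leq_trans (size_polyD _ _) _; rewrite size_polyN geq_max size_polyXn.
  apply/andP; split; first by lia.
  apply: leq_trans (size_polyMleq _ _) _; have := size_star K.*2 P.
  by move: sP; move: (size _) (size _) => a b; lia.
have symN : star K.*2.*2 N = N.
  apply: poly_eq_nz => w w0; rewrite star_horner // !NE ?cinv_neq0 // cinvK.
  rewrite rmorphM rmorphXn /= conj_cinv rmorphB rmorph1 rmorphM /= conjCK -addnn exprD exprVn.
  have wK : w ^+ K.*2 != 0 by rewrite expf_neq0.
  by field.
have posN z : z * z^* = 1 -> 0 < N.[z] * z^* ^+ K.*2.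
  move=> zz; have z0 : z != 0.
    by apply/eqP => z0; move: zz; rewrite z0 mul0r => /esym/eqP; rewrite oner_eq0.
  rewrite NE // cinv_circle // mulrAC -exprMn zz expr1n mul1r.
  rewrite horner_exp_poly //.
  have zV : z^-1 = z^* by rewrite -[RHS]mul1r -(mulVf z0) -mulrA zz mulr1.
  case: z zz z0 zV => a b zz z0 zV; rewrite zV conjC_Complex.
  have ab : a ^+ 2 + b ^+ 2 = 1.
    move: zz; rewrite conjC_Complex => /eqP; rewrite eq_complex /= => /andP[/eqP h _].
    by rewrite -h; ring.
  (* On the circle the average of [z] and its inverse is the real part [a], so the series is
     evaluated at an imaginary point of modulus at most [tau]. *)
  have -> : Complex 0 tau * (Complex a b + Complex a (- b)) / 2 = Complex 0 (tau * a).
    have -> : (2 : C) = Complex 2 0 by rewrite -(rmorph_nat (real_complex R)).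
    apply: (mulIf (x := Complex 2 0)).
      by rewrite eq_complex /= negb_and pnatr_eq0.
    rewrite divfK; last by rewrite eq_complex /= negb_and pnatr_eq0.
    by apply/eqP; rewrite eq_complex /=; apply/andP; split; apply/eqP; ring.
  have bnd : `|tau * a| <= tau.
    rewrite normrM (ger0_norm tau0) -[leRHS]mulr1 ler_wpM2l //.
    by rewrite -(ler_pXn2r (n := 2)) ?nnegrE ?normr_ge0 // real_normK ?num_real // expr1n
      -ab lerDl sqr_ge0.
  have := texp_bound bnd xT; move: (texp _ _) => E hE.
  have -> : (alpha%:C%C)^-1 * Complex a b ^+ K * E * ((alpha%:C%C)^-1 * Complex a b ^+ K * E)^* =
     ((alpha^-1) ^+ 2 * (complex.Re E ^+ 2 + complex.Im E ^+ 2))%:C%C.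
    rewrite !rmorphM rmorphXn /= add_Re2_Im2 normCK fmorphV fmorphV /= conjCR.
    have factor (x y z y' z' : C) : x * y * z * (x * y' * z') = (y * y') * (x * x * (z * z')).
      by ring.
    by rewrite factor -exprMn zz expr1n mul1r.
  rewrite subr_gt0 -[1](rmorph1 (real_complex R)) ltcR.
  have a0 : 0 < alpha by apply: le_lt_trans Talpha; rewrite addr_ge0 // mulr_ge0.
  rewrite exprVn ltr_pdivrMl ?exprn_gt0 // mulr1; apply: le_lt_trans hE _.
  by rewrite ltrXn2r // ?nnegrE ?(ltW a0) // addr_ge0 // mulr_ge0.
have [Q [sQ NQ]] := fejer_riesz sN symN posN; exists Q; split => // w w0.
apply: (mulfI (x := w ^+ K.*2)); first by rewrite expf_neq0.
by rewrite mulrDr -NQ // NE // mulr1; ring.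
Qed.

(** Matrix form of [horner_exp_poly]: the power of [Wi] cancels the shift by [W ^+ K]. *)
Lemma peval_exp_poly d (W Wi : 'M[C]_d) c alpha K : W *m Wi = 1%:M -> Wi *m W = 1%:M ->
  peval W (exp_poly c alpha K) *m Wi ^+ K =
  alpha^-1 *: expsum K.+1 (c *: (2^-1 *: (W + Wi))).
Proof.
move=> WWi WiW; rewrite pevalZ peval_sum -scalemxAl; congr (_ *: _).
rewrite mulmx_suml; apply: eq_bigr => -[k /= kK] _.
rewrite pevalZ pevalM !pevalXn pevalD pevalXn pevalX peval1 -scalemxAl.
rewrite !expmxZ scalerA scalerA exprMn exprVn; congr (_ *: _).
have WWiX j : W ^+ j *m Wi ^+ j = 1%:M.
  elim: j => [|j IH]; first by rewrite !expr0 mulmx1.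
  rewrite exprSr exprS -[LHS]mulmxA [X in _ *m X]mulmxA.
  by rewrite (_ : W *m Wi = 1%:M) // mul1mx.
have -> : Wi ^+ K = Wi ^+ (K - k) *m Wi ^+ k by rewrite -[_ *m _]exprD subnK.
rewrite mulmxA -(mulmxA _ (W ^+ _)) WWiX mulmx1.
have comm : GRing.comm (W ^+ 2 + 1%:M : 'M[C]_d) Wi.
  rewrite /GRing.comm; change ((W ^+ 2 + 1%:M) *m Wi = Wi *m (W ^+ 2 + 1%:M)).
  rewrite mulmxDl mulmxDr mulmx1 mul1mx expr2; congr (_ + _).
  change (W *m W *m Wi = Wi *m (W *m W)).
  by rewrite mulmxA WiW mul1mx -mulmxA WWi mulmx1.
rewrite -[LHS](exprMn_comm k comm); congr (_ ^+ k).
change ((W ^+ 2 + 1%:M) *m Wi = W + Wi); rewrite mulmxDl mul1mx expr2; congr (_ + _).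
by change (W *m W *m Wi = W); rewrite -mulmxA WWi mulmx1.
Qed.
End TruncatedExponential.

(** * The all-zero corner of the ancillas *)

Section AncillaCorner.
Variables (R : realType) (k m : nat).
Local Notation C := (R[i]).

Definition anc0 : 'I_(2 ^ k) := Ordinal (expn_gt0 2 k).

(** The isometry that adjoins all-zero ancillas; sandwiching [U] between it and its transpose gives
    the corner of [U]. *)
Definition incl : 'M[C]_(2 ^ (k + m), 2 ^ m) := \matrix_(x, s) (x == tidx anc0 s)%:R.

Lemma tidx0E (s : 'I_(2 ^ m)) : tidx anc0 s = s :> nat.
Proof. by rewrite /= mul0n add0n. Qed.

Lemma tidx0_inj : injective (tidx anc0 : 'I_(2 ^ m) -> 'I_(2 ^ (k + m))).
Proof. by move=> s s' /(congr1 val) /=; rewrite !mul0n !add0n => /val_inj. Qed.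

Lemma mul_incl p (M : 'M[C]_(p, _)) x s : (M *m incl) x s = M x (tidx anc0 s).
Proof.
rewrite mxE (bigD1 (tidx anc0 s)) //= mxE eqxx mulr1 big1 ?addr0 // => y ys.
by rewrite mxE (negbTE ys) mulr0.
Qed.

Lemma tr_incl_mul p (M : 'M[C]_(_, p)) s y : (incl^T *m M) s y = M (tidx anc0 s) y.
Proof.
rewrite mxE (bigD1 (tidx anc0 s)) //= !mxE eqxx mul1r big1 ?addr0 // => x xs.
by rewrite !mxE (negbTE xs) mul0r.
Qed.

Lemma incl_mul p (M : 'M[C]_(_, p)) s y : (incl *m M) (tidx anc0 s) y = M s y.
Proof.
rewrite mxE (bigD1 s) //= mxE eqxx mul1r big1 ?addr0 // => t ts.
rewrite mxE; case: eqP => [/tidx0_inj st|_]; last by rewrite mul0r.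
by rewrite st eqxx in ts.
Qed.

Lemma tr_incl_incl : incl^T *m incl = 1%:M.
Proof. by apply/matrixP => s s'; rewrite mul_incl !mxE (inj_eq tidx0_inj) eq_sym. Qed.

Lemma block_encoding_corner (U : 'M[C]_(2 ^ (k + m))) alpha A : 0 < alpha ->
  incl^T *m U *m incl = (alpha%:C%C)^-1 *: A -> block_encoding U alpha A.
Proof.
move=> a0 UA; split=> //; exists (delta_mx anc0 0); split.
  rewrite /vnorm2 (bigD1 anc0) //= mxE !eqxx normr1 expr1n big1 ?addr0 // => i /negbTE i0.
  by rewrite mxE i0 normr0 expr0n.
move=> s s'; rewrite (bigD1 anc0) //= [X in _ + X]big1 ?addr0 => [|i /negbTE i0]; last first.
  by rewrite big1 // => j _; rewrite mxE i0 conjC0 !mul0r.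
rewrite (bigD1 anc0) //= [X in _ + X]big1 ?addr0 => [|i /negbTE i0]; last first.
  by rewrite [X in _ * X]mxE i0 mulr0.
rewrite !mxE !eqxx conjC1 mul1r mulr1.
by move/matrixP/(_ s s'): UA; rewrite mul_incl tr_incl_mul mxE mulrC.
Qed.

(** Ancillas are the high-order digits, so ancilla [j] is qubit [m + j] although the register size
    reads [k + m]; hence the cast. *)
Definition ancilla (j : 'I_k) : 'I_(k + m) := cast_ord (addnC m k) (rshift m j).

Definition extend (P : pstring m) : pstring (k + m) :=
  [ffun q => if fintype.split (cast_ord (addnC k m) q) is inl i then P i else 0].

Lemma ancilla_inj : injective ancilla.
Proof. by move=> i j /(congr1 val) /= /addnI /val_inj. Qed.

Lemma extend_ancilla P j : extend P (ancilla j) = 0.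
Proof.
rewrite ffunE (_ : cast_ord _ _ = unsplit (inr j)) ?unsplitK //; exact: val_inj.
Qed.

Lemma extend_sys P i : extend P (cast_ord (addnC m k) (lshift k i)) = P i.
Proof.
rewrite ffunE (_ : cast_ord _ _ = unsplit (inl i)) ?unsplitK //; exact: val_inj.
Qed.

Lemma bit_small q x : (x < 2 ^ q)%N -> bit q x = false.
Proof. by move=> h; rewrite /bit divn_small. Qed.

Lemma bit_top x : (0 < x)%N -> bit (trunc_log 2 x) x.
Proof.
move=> x0; have /andP[h1 h2] := trunc_log_bounds (leqnn 2) x0.
rewrite /bit; suff -> : (x %/ 2 ^ trunc_log 2 x = 1)%N by [].
apply/eqP; rewrite eqn_leq leq_divRL ?expn_gt0 // mul1n h1 andbT.
by rewrite -ltnS ltn_divLR ?expn_gt0 // -expnS.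
Qed.

Lemma pauli_extend P : pauli_mx R (extend P) *m incl = incl *m pauli_mx R P.
Proof.
apply/matrixP => x s; rewrite mul_incl [LHS]mxE tidx0E.
rewrite (reindex (cast_ord (addnC m k))) /=; last first.
  by exists (cast_ord (addnC k m)) => i _; apply: val_inj.
rewrite big_split_ord /=.
under [X in _ * X]eq_bigr => j _.
  rewrite extend_ancilla sigma0 mxE (inj_eq b2o_inj) [bit (m + j) s]bit_small; last first.
    by rewrite (leq_trans (ltn_ord s)) // leq_exp2l // leq_addr.
  over.
under eq_bigr => i _ do rewrite extend_sys.
have [xm|mx] := ltnP x (2 ^ m).
  have -> : x = tidx anc0 (Ordinal xm).
    by apply: val_inj; exact: esym (tidx0E (Ordinal xm)).
  rewrite tidx0E [X in _ * X]big1 ?mulr1 => [|j _]; last first.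
    by rewrite bit_small ?eqxx // (leq_trans xm) // leq_exp2l // leq_addr.
  by rewrite incl_mul mxE.
rewrite [RHS]mxE [RHS]big1 => [|t _]; last first.
  rewrite mxE; case: eqP => [xt|]; last by rewrite mul0r.
  by move: mx; rewrite xt tidx0E leqNgt ltn_ord.
have x0 : (0 < x)%N by rewrite (leq_trans _ mx) // expn_gt0.
(* The leading digit of [x] sits on an ancilla, where [extend P] is the identity and [s] has digit
   0; this factor kills the left side. *)
have mt : (m <= trunc_log 2 x)%N by rewrite trunc_log_max.
have tk : (trunc_log 2 x - m < k)%N.
  rewrite ltn_subLR // (addnC m) -(ltn_exp2l _ _ (ltnSn 1)).
  by apply: leq_ltn_trans (ltn_ord x); apply: trunc_logP.
rewrite [X in _ * X](bigD1 (Ordinal tk)) //= subnKC //.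
by rewrite bit_top //= mul0r mulr0.
Qed.

Lemma zeros_incl (ls : seq 'I_(k + m)) : (forall q, q \in ls -> (m <= q)%N) ->
  zeros R ls *m incl = incl /\ incl^T *m zeros R ls = incl^T.
Proof.
move=> lsm; have ok (s : 'I_(2 ^ m)) : ctrl_ok (ctrl0 ls) (tidx anc0 s : 'I_(2 ^ (k + m))).
  apply/forallP => q; rewrite ffunE; case: ifP => [/lsm mq|//].
  by rewrite tidx0E bit_small // (leq_trans (ltn_ord s)) // leq_exp2l.
split; apply/matrixP => x y.
  by rewrite mul_incl ctlE mxE; case: eqP => [->|//]; rewrite ok.
by rewrite tr_incl_mul ctlE !mxE ok andbT eq_sym.
Qed.
End AncillaCorner.

(** * The corner of the simulation circuit *)

Section WalkCorner.
Variables (R : realType) (k m : nat).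
Local Notation C := (R[i]).
Local Notation J := (@incl R k m).
Variables (e q : 'I_(k + m)) (ls : seq 'I_(k + m)) (f : nat -> pstring (k + m) * R).
Hypotheses (fok : lcu_ok e ls f) (qe : q \notin e :: ls) (fq : forall i, (f i).1 q = 0).
Hypothesis anc_m : forall q', q' \in q :: e :: ls -> (m <= q')%N.
(** Stands for the average of the normalized terms on the system alone, rather than for the
    Hamiltonian itself. *)
Variable H : 'M[C]_(2 ^ m).
Hypothesis avgJ : pauli_average (size ls) f *m J = J *m H.

Lemma circuit_mx_nseq n (c : circuit R n) j : circuit_mx (flatten (nseq j c)) = circuit_mx c ^+ j.
Proof.
elim: j => [|j IH]; first by rewrite expr0.
by rewrite [flatten _]/= circuit_mx_cat IH exprSr.
Qed.

Lemma circuit_cost_nseq n (c : circuit R n) j :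
  circuit_cost (flatten (nseq j c)) = (j * circuit_cost c)%N.
Proof.
elim: j => [|j IH]; first by rewrite /circuit_cost big_nil.
by rewrite [flatten _]/= circuit_cost_cat IH mulSn.
Qed.

Lemma Forall_nseq n (Pr : gate R n -> Prop) (c : circuit R n) j :
  List.Forall Pr c -> List.Forall Pr (flatten (nseq j c)).
Proof. by move=> hc; elim: j => //= j IH; apply: ForallP_cat. Qed.

(** The inverse walks undo the shift z ^ K. They run uncontrolled, since only the branch with signal
    value 0 is kept. *)
Definition simulation R0 Rs K : circuit R (k + m) :=
  qsp_circuit q (walk e ls f) R0 Rs ++ flatten (nseq K (walk_inv e ls f)).

Local Notation W := (circuit_mx (walk e ls f)).
Local Notation Wi := (circuit_mx (walk_inv e ls f)).

Lemma walk_cos_incl : (2^-1 *: (W + Wi)) *m J = J *m (- H).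
Proof.
have [zJ _] : zeros R (e :: ls) *m J = J /\ J^T *m zeros R (e :: ls) = J^T.
  by apply: zeros_incl => q' hq; apply: anc_m; rewrite inE hq orbT.
rewrite -{1}zJ mulmxA walk_cos_zeros // -mulmxA mulNmx avgJ mulmxN mulmxA zJ.
by rewrite mulmxN.
Qed.

Lemma simulation_corner R0 Rs K c alpha Q :
  qsp R0 Rs = (exp_poly c alpha K, Q) ->
  J^T *m circuit_mx (simulation R0 Rs K) *m J = alpha^-1 *: expsum K.+1 (c *: (- H)).
Proof.
move=> PQ; have [frw frwi] := walk_free qe fq.
have WWi := walkK fok; have WiW := walk_invK fok.
have zq : one_qubit_mx q (proj R false) = zeros R [:: q] by rewrite zeros_cons // zeros_nil mulmx1.
have [qJ Jq] : zeros R [:: q] *m J = J /\ J^T *m zeros R [:: q] = J^T.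
  by apply: zeros_incl => q'; rewrite inE => /eqP ->; apply: anc_m; rewrite mem_head.
rewrite circuit_mx_cat circuit_mx_nseq -[X in _ *m X = _]qJ -zq !mulmxA -(mulmxA _ (circuit_mx _)).
rewrite (qsp_circuit_mx (q := q) frw) PQ mulmxDr mulmxDl.
have Wqu u : W *m one_qubit_mx q u = one_qubit_mx q u *m W by apply: circuit_comm.
have Wiq u : Wi *m one_qubit_mx q u = one_qubit_mx q u *m Wi by apply: circuit_comm.
have WiqX u : Wi ^+ K *m one_qubit_mx q u = one_qubit_mx q u *m Wi ^+ K.
  elim: K {PQ} => [|j IH]; first by rewrite expr0 mul1mx mulmx1.
  by rewrite exprS -[_ *m one_qubit_mx _ _]mulmxA IH mulmxA Wiq -mulmxA.
(* The complement [Q] leaves the signal qubit in state 1, which the corner discards. *)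
have -> : J^T *m Wi ^+ K *m (peval W (exp_poly c alpha K, Q).2 *m one_qubit_mx q (mx2 0 0 1 0)) = 0.
  set Q' := peval _ _; have Qc u : Q' *m one_qubit_mx q u = one_qubit_mx q u *m Q'.
    exact: peval_comm.
  rewrite -Jq -zq -!mulmxA Qc (mulmxA (Wi ^+ K)) WiqX -mulmxA.
  rewrite (mulmxA (one_qubit_mx q _)) one_qubitM.
  have -> : proj R false *m mx2 0 0 1 0 = 0.
    rewrite mx2_proj0 mx2M; apply/matrixP => i j; rewrite !mxE.
    by rewrite !(mulr0, mul0r, mul1r, addr0) !if_same.
  by rewrite -(scale0r 0) one_qubitZ scale0r mul0mx mulmx0.
rewrite mul0mx addr0 -mx2_proj0 zq -!mulmxA qJ /=.
have comm : W *m Wi ^+ K = Wi ^+ K *m W.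
  elim: K {PQ WiqX} => [|j IH]; first by rewrite expr0 mul1mx mulmx1.
  by rewrite exprS [LHS]mulmxA WWi -[RHS]mulmxA -IH mulmxA WiW.
rewrite (mulmxA (Wi ^+ K)) -(peval_comm _ comm) peval_exp_poly // -scalemxAl -scalemxAr.
congr (_ *: _).
rewrite (_ : expsum _ _ *m J = J *m expsum K.+1 (c *: (- H))).
  by rewrite mulmxA tr_incl_incl mul1mx.
rewrite /expsum mulmx_suml mulmx_sumr; apply: eq_bigr => i _.
rewrite -scalemxAl -scalemxAr; congr (_ *: _); apply: expmx_mull.
by rewrite -scalemxAl walk_cos_incl -scalemxAr.
Qed.
End WalkCorner.

(** * Terms of the Hamiltonian and the simulation circuit *)

Section HamiltonianTerms.
Variables (R : realType) (NL nq : nat) (S : {set {set 'I_NL}}).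
Variable dec : {set 'I_NL} -> seq (pstring (NL * nq) * R).
Local Notation C := (R[i]).
Local Notation m := (NL * nq)%N.
Local Notation cP := (cP_of S dec).

Definition terms := flatten [seq dec J | J <- enum S].

Lemma ham_termsE : ham_mx S dec = \sum_(pc <- terms) pc.2%:C%C *: pauli_mx R pc.1.
Proof. by rewrite /ham_mx /terms big_flatten big_map big_enum. Qed.

(** Supports are subsets of the [NL] sites, so their number is at most [2 ^ NL], a constant on a
    fixed lattice. *)
Lemma size_terms : (size terms <= 2 ^ NL * NP_of S dec)%N.
Proof.
rewrite size_flatten sumnE /shape -map_comp big_map big_enum /=.
apply: (@leq_trans (\sum_(J in S) NP_of S dec)).
  by apply: leq_sum => J JS; rewrite /NP_of (bigD1 J JS) leq_maxl.
rewrite sum_nat_const leq_mul2r; apply/orP; right.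
by apply: leq_trans (max_card _) _; rewrite -cardsT -powersetT card_powerset cardsT card_ord.
Qed.

Lemma terms_le_cP pc : pc \in terms -> `|pc.2| <= cP.
Proof.
move=> /flatten_mapP[J]; rewrite mem_enum => JS pcJ.
apply: (le_trans _ (le_bigmax_cond 0 (fun J => \big[Num.max/0]_(pc <- dec J) `|pc.2|) JS)).
exact: (le_bigmax_seq 0 pc predT (fun pc => `|pc.2|) pcJ isT).
Qed.

Lemma cP_ge0 : 0 <= cP.
Proof. exact: bigmax_ge_id. Qed.

(** Zero-weight padding that brings the number of terms up to a power of two. *)
Definition term0 : pstring m * R := ([ffun=> 0], 0).
Definition term i := nth term0 terms i.

Lemma term_le_cP i : `|(term i).2| <= cP.
Proof.
have [h|h] := ltnP i (size terms); first exact: terms_le_cP (mem_nth _ h).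
by rewrite /term nth_default //= normr0 cP_ge0.
Qed.

Lemma sum_term (V : zmodType) (G : pstring m * R -> V) a : G term0 = 0 ->
  (size terms <= 2 ^ a)%N -> \sum_(i < 2 ^ a) G (term i) = \sum_(pc <- terms) G pc.
Proof.
move=> G0 sa; rewrite [RHS](big_nth term0) big_mkord.
rewrite (big_ord_widen (2 ^ a) (fun i => G (nth term0 terms i)) sa).
rewrite [LHS](bigID (fun i : 'I_(2 ^ a) => (i < size terms)%N)) /=.
rewrite [X in _ + X]big1 ?addr0 // => i; rewrite -leqNgt => h.
by rewrite /term nth_default.
Qed.

Lemma term_ratio i : cP * ((term i).2 / cP) = (term i).2.
Proof.
have [c0|c0] := eqVneq cP 0; last by rewrite mulrC divfK.
by have := term_le_cP i; rewrite c0 normr_le0 => /eqP ->; rewrite mul0r.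
Qed.

Lemma opnorm_ham a : (size terms <= 2 ^ a)%N -> opnorm_le (ham_mx S dec) (2 ^+ a * cP).
Proof.
move=> sa; rewrite ham_termsE -(sum_term (G := fun pc => pc.2%:C%C *: pauli_mx R pc.1) _ sa).
  have -> : 2 ^+ a * cP = \sum_(i < 2 ^ a) cP by rewrite sumr_const card_ord -natrX mulr_natl.
  apply: opnorm_le_sum => i _; first exact: cP_ge0.
  rewrite -[cP]mulr1; apply: opnorm_leZ; last exact: opnorm_le_pauli.
  by rewrite /= expr0n addr0 -real_normK ?num_real // lerXn2r ?nnegrE ?cP_ge0 ?term_le_cP.
by rewrite /= scale0r.
Qed.

(** Division by [cP] brings the weights into [-1, 1], as [reflection] demands. *)
Definition lcu_term k i : pstring (k + m) * R := (extend k (term i).1, (term i).2 / cP).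

Lemma lcu_term_le1 k i : `|(lcu_term k i).2| <= 1.
Proof.
rewrite /= normrM normfV (ger0_norm cP_ge0).
have [->|c0] := eqVneq cP 0; first by rewrite invr0 mulr0.
by rewrite ler_pdivrMr ?mul1r ?term_le_cP // lt_def c0 cP_ge0.
Qed.

(** Stating the scaling as a product also covers [cP = 0], where all weights vanish and both sides
    are 0. *)
Lemma lcu_term_average k a : (size terms <= 2 ^ a)%N ->
  exists H : 'M[C]_(2 ^ m), (2 ^+ a * cP)%:C%C *: H = ham_mx S dec /\
   pauli_average a (lcu_term k) *m incl R k m = incl R k m *m H.
Proof.
move=> sa; exists ((2 ^- a) *: \sum_(i < 2 ^ a) ((term i).2 / cP)%:C%C *: pauli_mx R (term i).1).
split.
  rewrite ham_termsE -(sum_term (G := fun pc => pc.2%:C%C *: pauli_mx R pc.1) _ sa); last first.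
    by rewrite /= scale0r.
  have -> : (2 ^+ a * cP)%:C%C = cP%:C%C * 2 ^+ a :> C.
    by rewrite mulrC rmorphM rmorphXn /= rmorph_nat.
  rewrite scalerA mulfK ?expf_neq0 ?pnatr_eq0 // scaler_sumr; apply: eq_bigr => i _.
  by rewrite scalerA -(rmorphM (real_complex R)) /= term_ratio.
rewrite /pauli_average -scalemxAl -scalemxAr mulmx_suml mulmx_sumr; congr (_ *: _).
by apply: eq_bigr => i _; rewrite -scalemxAl -scalemxAr pauli_extend.
Qed.
End HamiltonianTerms.

(** * Assembly of the circuit, choice of the degree and cost *)

Section Simulation.
Variables (R : realType) (NL nq : nat) (S : {set {set 'I_NL}}).
Variable dec : {set 'I_NL} -> seq (pstring (NL * nq) * R).
Local Notation C := (R[i]).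
Local Notation m := (NL * nq)%N.
Local Notation cP := (cP_of S dec).
Local Notation NP := (NP_of S dec).

(** The [a.+2] ancillas are the signal qubit [q], the weight qubit [e] and the [a] label qubits. *)
Lemma ancilla_split a : exists q e (ls : seq 'I_(a.+2 + m)),
  [/\ q \notin e :: ls, uniq (e :: ls), size ls = a,
     (forall q', q' \in q :: e :: ls -> (m <= q')%N) &
     forall (P : pstring m) q', q' \in q :: e :: ls -> extend a.+2 P q' = 0].
Proof.
have : uniq [seq ancilla m j | j <- enum 'I_a.+2].
  by rewrite map_inj_uniq ?enum_uniq //; exact: ancilla_inj.
have : size [seq ancilla m j | j <- enum 'I_a.+2] = a.+2 by rewrite size_map size_enum_ord.
have h1 q' : q' \in [seq ancilla m j | j <- enum 'I_a.+2] -> (m <= q')%N.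
  by case/mapP => j _ ->; exact: leq_addr.
have h2 (P : pstring m) q' : q' \in [seq ancilla m j | j <- enum 'I_a.+2] -> extend a.+2 P q' = 0.
  by case/mapP => j _ ->; exact: extend_ancilla.
move: h1 h2; case: [seq _ | _ <- _] => [|q [|e ls]] //= h1 h2 [sls] /andP[qe uls].
by exists q, e, ls; split.
Qed.

Lemma simulation_exists a K (t eps : R) : 0 < t -> 0 < eps ->
  (size (terms S dec) <= 2 ^ a)%N ->
  exp_tail_le K.+1 (2 ^+ a * cP * t) eps ->
  exists (c : circuit R (a.+2 + m)) (A : 'M[C]_(2 ^ m)),
    [/\ circuit_wf c, block_encoding (circuit_mx c) (1 + 3 * eps) A,
      opnorm_le (A - mexp (Complex 0 (- t) *: ham_mx S dec)) eps &
      (circuit_cost c <= 26 * K.+1 * 2 ^ a * a.+1)%N].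
Proof.
move=> t0 eps0 sa xT; set tau := 2 ^+ a * cP * t in xT.
have l0 : 0 <= 2 ^+ a * cP by rewrite mulr_ge0 ?exprn_ge0 ?cP_ge0.
have tau0 : 0 <= tau by rewrite mulr_ge0 // ltW.
have [q [e [ls [qe uls sls anc_m extP]]]] := ancilla_split a.
pose f := lcu_term S dec a.+2.
have fok : lcu_ok e ls f.
  split=> // i; split; first exact: lcu_term_le1.
  by move=> q' hq; apply: extP; rewrite inE hq orbT.
have fq i : (f i).1 q = 0 by apply: extP; rewrite mem_head.
have [H [HE avgJ]] := lcu_term_average a.+2 sa.
have [Q [sQ PQ1]] : exists Q : {poly C}, (size Q <= K.*2.+1)%N /\ forall w, w != 0 ->
    (exp_poly (Complex 0 tau) (1 + 3 * eps)%:C%C K).[w] *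
    ((exp_poly (Complex 0 tau) (1 + 3 * eps)%:C%C K).[cinv w])^* + Q.[w] * (Q.[cinv w])^* = 1.
  apply: exp_poly_complement xT => //; lra.
have [R0 [Rs [uR0 uRs sRs PQ]]] := qsp_exists (size_exp_poly _ _ _) sQ PQ1.
have [wfw wfwi] := walk_wf fok; have [frw frwi] := walk_free qe fq.
exists (simulation e q ls f R0 Rs K), (expsum K.+1 (Complex 0 (- t) *: ham_mx S dec)); split.
- apply: circuit_wfP; apply: ForallP_cat; first exact: qsp_circuit_wf.
  exact: Forall_nseq.
- apply: block_encoding_corner; first by rewrite addr_gt0 // mulr_gt0.
  have avgJ' : pauli_average (size ls) f *m incl R a.+2 m = incl R a.+2 m *m H by rewrite sls.
  have HtE : Complex 0 tau *: (- H) = Complex 0 (- t) *: ham_mx S dec.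
    rewrite -HE scalerN scalerA -scaleNr; congr (_ *: _).
    by apply/eqP; rewrite eq_complex /=; apply/andP; split; apply/eqP; rewrite /tau; ring.
  by rewrite -HtE -(simulation_corner fok qe fq anc_m avgJ' PQ).
- apply: expsum_mexp xT => //.
  have -> : tau = t * (2 ^+ a * cP) by rewrite mulrC.
  by apply: opnorm_leZ; last exact: opnorm_ham sa; rewrite /= expr0n add0r sqrrN.
- rewrite circuit_cost_cat circuit_cost_nseq.
  have h1 := qsp_circuit_cost q (walk e ls f) R0 Rs.
  have [h2 h3] := walk_cost e ls f; have h4 := walk_size e ls f.
  apply: leq_trans (leq_add h1 (leqnn _)) _; rewrite sRs.
  rewrite sls in h2 h3 h4; have h5 : (0 < 2 ^ a)%N by rewrite expn_gt0.
  move: h2 h3 h4 h5; move: (circuit_cost _) (circuit_cost _) (size _) (2 ^ a)%N => x y z p.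
  move=> h2 h3 h4 h5.
  (* Each of the 2 K controlled walks pays one extra unit per gate and one rotation, and [K] plain
     inverse walks follow: at most 25 K + 1 multiples of [p * a.+1]. *)
  apply: (@leq_trans (1 + K.*2 * (5 * p * a.+1 + 4 * p + 1) + K * (5 * p * a.+1))%N).
    rewrite -!addnA leq_add2l; apply: leq_add; last by rewrite leq_mul2l h3 orbT.
    by rewrite leq_mul2l; apply/orP; right; lia.
  nia.
Qed.

(** Chernoff's bound leaves exp(e tau - K - 1); taking for [K] the floor of e tau + M, with [M] the
    maximum, brings it below exp(- M) <= eps. The lower bound 1 on [M] absorbs the rounding and
    covers a negative logarithm. *)
Lemma degree_exists (tau eps : R) : 0 <= tau -> 0 < eps ->
  exists K, exp_tail_le K.+1 tau eps /\
   (K.+1)%:R <= (expR 1 + 2) * (tau + Num.max 1 (ln (1 / eps))).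
Proof.
move=> tau0 eps0; set M := Num.max _ _.
have M1 : 1 <= M by rewrite le_max lexx.
have e0 : 0 <= expR 1 :> R by exact: expR_ge0.
have x0 : 0 <= expR 1 * tau + M by rewrite addr_ge0 ?mulr_ge0 // (le_trans ler01).
exists (Num.truncn (expR 1 * tau + M)); have /andP[K1 K2] := truncn_itv x0; split.
  move=> N; apply: le_trans (exp_tail_chernoff _ tau0 N) _.
  rewrite -[leRHS]lnK ?posrE // ler_expR.
  have : ln (1 / eps) <= M by rewrite le_max lexx orbT.
  rewrite div1r lnV ?posrE //; lra.
rewrite -natr1; nra.
Qed.

End Simulation.

(** For [NP = 0] the cost bound is 0, which forces the empty circuit; the Hamiltonian vanishes and
    its exponential is the identity. *)
Lemma trivial_simulation (R : realType) (NL nq : nat) (S : {set {set 'I_NL}})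
    (dec : {set 'I_NL} -> seq (pstring (NL * nq) * R)) (t eps : R) :
  NP_of S dec = 0%N -> 0 < eps ->
  block_encoding (circuit_mx ([::] : circuit R (0 + NL * nq))) 1
    (1%:M : 'M[R[i]]_(2 ^ (NL * nq))) /\
  opnorm_le (1%:M - mexp (Complex 0 (- t) *: ham_mx S dec)) eps.
Proof.
move=> NP0 eps0; split.
  apply: block_encoding_corner => //; rewrite circuit_mx_nil mulmx1 tr_incl_incl.
  by rewrite rmorph1 invr1 scale1r.
have ham0 : ham_mx S dec = 0.
  have : (size (terms S dec) <= 0)%N by have := size_terms S dec; rewrite NP0 muln0.
  by rewrite leqn0 size_eq0 ham_termsE => /eqP ->; rewrite big_nil.
rewrite ham0 scaler0; set M : 'M[R[i]]_(2 ^ (NL * nq)) := 0.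
have -> : 1%:M = expsum 1 M by rewrite /expsum big_ord1 fact0 invr1 scale1r expr0.
apply: (expsum_mexp (x := 0)) => //; first exact: opnorm_le0.
move=> N; rewrite big_nat_cond big1 ?ltW // => k /andP[/andP[k0 _] _].
by rewrite /exp_coeff /= expr0n gtn_eqF // mul0r.
Qed.

Theorem theorem3p8 (R : realType) (NL kloc : nat) :
  exists Cst : R, 0 < Cst /\
  forall (nq : nat) (S : {set {set 'I_NL}})
         (dec : {set 'I_NL} -> seq (pstring (NL * nq) * R)),
  site_local kloc S dec ->
  forall t eps : R, 0 < t -> 0 < eps ->
  let NP := NP_of S dec in
  let cP := cP_of S dec in
  exists (kanc : nat) (c : circuit R (kanc + NL * nq)) (alpha : R)
         (A : 'M[R[i]]_(2 ^ (NL * nq))),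
    circuit_wf c /\
    [/\ block_encoding (circuit_mx c) alpha A,
        opnorm_le (A - mexp (Complex 0 (- t) *: ham_mx S dec)) eps,
        `|alpha - 1| <= Cst * eps,
        (kanc%:R <= Cst * ((trunc_log 2 NP).+1)%:R)
      & ((circuit_cost c)%:R <=
           Cst * NP%:R * ((trunc_log 2 NP).+1)%:R
               * (NP%:R * cP * t + Num.max 1 (ln (1 / eps))))].
Proof.
(* [2 ^+ NL] bounds the number of supports, and the further factor 2 rounds [NP] up to a power of
   two. *)
set D : R := 2 ^+ NL.+1; set E : R := expR 1 + 2.
have D1 : 1 <= D by rewrite exprn_ege1 // ler1n.
have E0 : 0 < E by rewrite addr_gt0 ?expR_gt0.
set L : R := NL%:R; have L0 : 0 <= L by rewrite ler0n.
(* One factor [D] comes from [2 ^ a] inside the degree, the other from the cost of a walk; [E] is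
   the constant of the degree, and [L + 2] bounds the ratio of [a.+1] to [l.+1]. *)
set G : R := 26 * E * D * D * (L + 2).
have D0 : 0 <= D := le_trans ler01 D1.
have G0 : 0 <= G by rewrite /G !mulr_ge0 ?(ltW E0) ?addr_ge0.
(* The common constant must dominate 3 for [alpha], [L + 3] for the ancillas and [G] for the
   cost. *)
have [C0 C3 CL CG] : [/\ 0 <= L + 6 + G, 3 <= L + 6 + G, L + 3 <= L + 6 + G & G <= L + 6 + G].
  by split; lra.
exists (L + 6 + G); split; first exact: lt_le_trans C3.
move=> nq S dec _ t eps t0 eps0 NP cP.
have [NP0|NPn0] := eqVneq NP 0%N.
  have [be ex] := trivial_simulation t NP0 eps0.
  exists 0%N, [::], 1, 1%:M; split; first by [].
  split=> //; first by rewrite subrr normr0 mulr_ge0 ?(ltW eps0).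
    by rewrite mulr_ge0 ?ler0n.
  by rewrite /circuit_cost big_nil NP0 mulr0 !mul0r.
set l := trunc_log 2 NP; pose a := (NL + l.+1)%N.
have /andP[NPl NPu] : (2 ^ l <= NP < 2 ^ l.+1)%N by apply: trunc_log_bounds; rewrite // lt0n.
have sa : (size (terms S dec) <= 2 ^ a)%N.
  by apply: leq_trans (size_terms S dec) _; rewrite expnD leq_mul2l (ltnW NPu) orbT.
have c0 : 0 <= cP by exact: cP_ge0.
have tau0 : 0 <= 2 ^+ a * cP * t by rewrite !mulr_ge0 ?exprn_ge0 // ltW.
have [K [xT KE]] := degree_exists tau0 eps0.
have [c [A [wfc be ex cost]]] := simulation_exists t0 eps0 sa xT.
set M := Num.max 1 (ln (1 / eps)) in KE *.
have M1 : 1 <= M by rewrite le_max lexx.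
have aD : 2 ^+ a <= D * NP%:R :> R.
  rewrite /a -addSnnS exprD ler_wpM2l ?(le_trans ler01) //.
  by rewrite -natrX ler_nat.
have al : a.+1%:R <= (L + 2) * l.+1%:R :> R.
  rewrite /L -natrD -natrM ler_nat /a; move: (l) => j; clear; nia.
have NPR : 1 <= NP%:R :> R by rewrite ler1n lt0n.
have l1 : 1 <= l.+1%:R :> R by rewrite ler1n.
have N0 : 0 <= NP%:R * cP * t by rewrite !mulr_ge0 ?ler0n // ltW.
exists a.+2, c, (1 + 3 * eps), A; split=> //; split => //.
- rewrite addrC addKr ger0_norm; last by rewrite mulr_ge0 // ltW.
  by rewrite ler_wpM2r // ltW.
- rewrite -natr1; apply: (@le_trans _ _ ((L + 3) * l.+1%:R)); last by rewrite ler_wpM2r ?ler0n.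
  have -> : L + 3 = L + 2 + 1 by ring.
  by rewrite [leRHS]mulrDl mul1r lerD.
have KD : K.+1%:R <= E * (D * (NP%:R * cP * t + M)).
  apply: le_trans KE _; rewrite ler_wpM2l ?(ltW E0) // mulrDr lerD //.
    by rewrite !mulrA ler_wpM2r ?(ltW t0) // ler_wpM2r.
  by rewrite -[leLHS]mul1r ler_wpM2r // (le_trans ler01).
apply: (@le_trans _ _ (26 * K.+1%:R * 2 ^+ a * a.+1%:R)).
  by rewrite -natrX -!natrM ler_nat.
apply: (@le_trans _ _ (26 * (E * (D * (NP%:R * cP * t + M))) * (D * NP%:R) * ((L + 2) * l.+1%:R))).
  rewrite ler_pM ?mulr_ge0 ?exprn_ge0 ?ler0n // ler_pM ?mulr_ge0 ?exprn_ge0 ?ler0n //.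
  by rewrite ler_wpM2l.
rewrite [leLHS](_ : _ = G * NP%:R * l.+1%:R * (NP%:R * cP * t + M)); last by rewrite /G; ring.
have NM : 0 <= NP%:R * cP * t + M by rewrite addr_ge0 // (le_trans ler01).
by rewrite ler_wpM2r // ler_wpM2r ?ler0n // ler_wpM2r ?ler0n.
Qed.
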